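(* Let $\varepsilon\searrow0$ be an infinitesimal sequence of positive real numbers and let $(\mu_\varepsilon)_\varepsilon\subset\mathcal M(\Omega;E)$ be a sequence of measures with uniformly bounded total variation. Then there exist a subsequence $(\varepsilon_k)_{k\in\mathbb N}$, a positive measure $\kappa\in\mathcal M(\overline\Omega)$, and a weak-* $\kappa$-measurable map $\theta:\overline\Omega\to\mathcal M(Z;E)$ such that $\mu_{\varepsilon_k}$ two-scale converges to $\kappa\otimes\theta_x$. Moreover $$(\kappa\otimes|\theta_x|)(\overline\Omega\times Z)\le\liminf_{\varepsilon\downarrow0}|\mu_\varepsilon|(\Omega).$$
   Context: $\Omega\subset\mathbb R^d$ is open and bounded with $\mathscr L^d(\partial\Omega)=0$; $Z=\mathbb T^d=\mathbb R^d/\mathbb Z^d$; $E$ is a finite-dimensional Euclidean space; $\mathcal M(\cdot;E)$ denotes bounded $E$-valued Radon measures. A map $x\mapsto\theta_x$ into measures on $Z$ is weak-* $\kappa$-measurable if $x\mapsto\theta_x(B)$ is $\kappa$-measurable for every Borel $B\subset Z$; $(\kappa\otimes\theta_x)(U)=\int\int\chi_U(x,\xi)\,d\theta_x(\xi)\,d\kappa(x)$. Two-scale convergence: $(\mu_\varepsilon)_\varepsilon\subset\mathcal M(\Omega;E)$ two-scale converges (as $\varepsilon\downarrow0$) to $\kappa\otimes\theta_x$ if $$\int_\Omega\Psi\Big(x,\frac x\varepsilon\Big)\,d\mu_\varepsilon(x)\to\int_{\overline\Omega}\Big(\int_Z\Psi(x,\xi)\,d\theta_x(\xi)\Big)d\kappa(x)\qquad\text{for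 all }\Psi\in C(\overline\Omega\times Z),$$ where $x/\varepsilon$ is taken modulo $\mathbb Z^d$. *)

(* Defs.v *)
From HB Require Import structures.
From mathcomp Require Import all_boot all_order all_algebra.
From mathcomp Require Import generic_quotient ring.
From mathcomp Require Import all_classical all_reals all_analysis.
From mathcomp Require Import measurable_realfun.

Set Implicit Arguments.
Unset Strict Implicit.
Unset Printing Implicit Defensive.

Import Order.TTheory GRing.Theory Num.Theory.
Import numFieldNormedType.Exports.

Local Open Scope classical_set_scope.
Local Open Scope ring_scope.

Notation borel T := (g_sigma_algebraType (@open T)).

(* A finite-dimensional Euclidean space is a [vectType R] together with an
   inner product [dot]; norm, convergence and open sets are those of [dot]. *)
Section euclidean.
Context {R : realType} {E : vectType R} (dot : {dot E for @idfun R}).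

Definition enorm (v : E) : R := Num.sqrt (dot v v).

Definition ecvg (u : nat -> E) (v : E) :=
  enorm (u n - v) @[n --> \oo] --> (0 : R).

Definition eopen (V : set E) :=
  forall v, V v -> exists2 r : R, 0 < r & forall w, enorm (w - v) < r -> V w.

Lemma dot_ge0 (v : E) : 0 <= dot v v.
Proof.
have [->|v0] := eqVneq v 0; first by rewrite linear0r.
by apply: ltW; exact: neq0_dnorm_gt0.
Qed.

Lemma dotC (u v : E) : dot u v = dot v u.
Proof. by rewrite [LHS]hermitian_subproof expr0 mul1r. Qed.

Lemma dot_le_enorm (u v : E) : `|dot u v| <= enorm u * enorm v.
Proof.
have [->|v0] := eqVneq v 0.
  by rewrite linear0r normr0 mulr_ge0 ?sqrtr_ge0.
have vv : 0 < dot v v by exact: neq0_dnorm_gt0.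
rewrite /enorm -sqrtrM ?dot_ge0// -sqrtr_sqr ler_wsqrtr//.
have := dot_ge0 (u - (dot u v / dot v v) *: v).
rewrite linearBl !linearBr /= !linearZl_LR !linearZr_LR /= (dotC v u).
move: vv; set a := dot u v; set b := dot v v; set c := dot u u => b0.
rewrite (_ : _ - (_ - _) = c - a ^+ 2 / b); last first.
  by rewrite /GRing.scale/=; field; rewrite gt_eqF.
by rewrite subr_ge0 ler_pdivrMr.
Qed.

Local Lemma dotZr (a : R) (u v : E) : dot u (a *: v) = a * dot u v.
Proof. by rewrite linearZr_LR. Qed.

Local Lemma dotZl (a : R) (u v : E) : dot (a *: u) v = a * dot u v.
Proof. by rewrite dotC dotZr dotC. Qed.

Local Lemma dot_sumr (n : nat) (c : 'I_n -> R) (f : 'I_n -> E) (u : E) :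
  dot u (\sum_i c i *: f i) = \sum_i c i * dot u (f i).
Proof. by rewrite linear_sumr; apply: eq_bigr => i _; exact: dotZr. Qed.

Local Lemma dot_suml (n : nat) (c : 'I_n -> R) (f : 'I_n -> E) (u : E) :
  dot (\sum_i c i *: f i) u = \sum_i c i * dot (f i) u.
Proof. by rewrite dotC dot_sumr; apply: eq_bigr => i _; rewrite dotC. Qed.

Local Notation b := (vbasis {:E}).

Let gram : 'M[R]_(\dim {:E}) := \matrix_(j, k) dot b`_j b`_k.

Let gram_unit : gram \in unitmx.
Proof.
rewrite -row_free_unit -kermx_eq0; apply/eqP/row_matrixP => i.
set r := row i _; have : r *m gram = 0.
  by apply/sub_kermxP; exact: row_sub.
rewrite row0 => r0.
pose v := \sum_j r ord0 j *: b`_j.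
have vb (k : 'I_(\dim {:E})) : dot v b`_k = 0.
  transitivity ((r *m gram) ord0 k); last by rewrite r0 mxE.
  rewrite dot_suml [RHS]mxE; apply: eq_bigr => j _.
  by rewrite [gram _ _]mxE.
have v0 : v = 0.
  apply/eqP; apply: contraT => vn0.
  have : 0 < dot v v by exact: neq0_dnorm_gt0.
  by rewrite {2}/v dot_sumr big1 ?ltxx// => k _; rewrite vb mulr0.
apply/rowP => j; rewrite [RHS]mxE.
have /freeP/(_ (fun j => r ord0 j)) := basis_free (vbasisP {:E}).
by move=> /(_ v0 j).
Qed.

Let dual (i : 'I_(\dim {:E})) : E := \sum_k (invmx gram) k i *: b`_k.

Let coord_dual i (v : E) : coord b i v = dot v (dual i).
Proof.
rewrite [v in RHS](coord_vbasis (memvf v)) dot_suml.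
have dualE (j : 'I_(\dim {:E})) : dot b`_j (dual i) = (j == i)%:R.
  transitivity ((gram *m invmx gram) j i); last by rewrite mulmxV// mxE.
  by rewrite dot_sumr mxE; apply: eq_bigr => k _; rewrite mxE mulrC.
rewrite (bigD1 i)//= dualE eqxx mulr1 big1 ?addr0// => j ji.
by rewrite dualE (negbTE ji) mulr0.
Qed.

Lemma coord_le i : exists2 M : R, 0 <= M &
  forall v : E, `|coord b i v| <= M * enorm v.
Proof.
exists (enorm (dual i)); first exact: sqrtr_ge0.
by move=> v; rewrite coord_dual mulrC dot_le_enorm.
Qed.

End euclidean.

Section charge_integral.
Context {R : realType} {disp : measure_display} {T : measurableType disp}.
Variable nu : {charge set T -> \bar R}.

Let hahn_ex : exists PN : set T * set T, hahn_decomposition nu PN.1 PN.2.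
Proof. by have [P [N PN]] := Hahn_decomposition nu; exists (P, N). Qed.

Let hahnPN := projT2 (cid hahn_ex).

(* [\int f dnu = \int f dnu^+ - \int f dnu^-]; the Jordan decomposition does
   not depend on the chosen Hahn decomposition. *)
Definition charge_integral (D : set T) (f : T -> R) : R :=
  Rintegral (jordan_pos hahnPN) D f - Rintegral (jordan_neg hahnPN) D f.

End charge_integral.

Section vector_measure.
Context {R : realType} {E : vectType R} (dot : {dot E for @idfun R}).

Record vmeasure (disp : measure_display) (T : measurableType disp) := VMeasure {
  vmeasure_fun :> set T -> E ;
  vmeasure0 : vmeasure_fun set0 = 0 ;
  vmeasure_sigma_additive : forall F : nat -> set T,
    (forall k, measurable (F k)) -> trivIset [set: nat] F ->
    ecvg dot (fun n => \sum_(k < n) vmeasure_fun (F k))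
             (vmeasure_fun (\bigcup_k F k)) }.

Context {disp : measure_display} {T : measurableType disp}.
Implicit Types (mu : vmeasure T) (D : set T).

Definition concentrated_on mu D :=
  forall A, measurable A -> A `&` D = set0 -> mu A = 0.

Definition vtotal_variation mu (A : set T) : \bar R :=
  ereal_sup [set (\sum_(k <oo) (enorm dot (mu (F k)))%:E)%E | F in
    [set F : nat -> set T | [/\ forall k, measurable (F k),
       trivIset [set: nat] F & \bigcup_k F k = A]]].

Local Notation b := (vbasis {:E}).

Definition vcoord mu (i : 'I_(\dim {:E})) (A : set T) : \bar R :=
  (coord b i (mu A))%:E.

Section vcoord_charge.
Variables (mu : vmeasure T) (i : 'I_(\dim {:E})).

Let vcoord0 : vcoord mu i set0 = 0%E.
Proof. by rewrite /vcoord vmeasure0 linear0. Qed.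

Let vcoord_fin A : measurable A -> vcoord mu i A \is a fin_num.
Proof. by []. Qed.

Let vcoord_sigma_additive : semi_sigma_additive (vcoord mu i).
Proof.
move=> F mF tF _; rewrite /vcoord.
have [M M0 coordM] := coord_le dot i.
have muF := vmeasure_sigma_additive mu mF tF.
under eq_fun do rewrite sumEFin.
apply/cvg_EFin; first exact: nearW.
rewrite /comp/=.
apply/subr_cvg0.
apply/norm_cvg0P.
apply: (@squeeze_cvgr _ _ _ _ (cst 0)
  (fun n => M * enorm dot (\sum_(k < n) mu (F k) - mu (\bigcup_k F k)))).
- apply: nearW => n /=; rewrite normr_ge0/=.
  by rewrite big_mkord -linear_sum -linearB coordM.
- exact: cvg_cst.
- by rewrite -(mulr0 M); apply: cvgMr.
Qed.

HB.instance Definition _ := isCharge.Build _ _ _ (vcoord mu i)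
  vcoord0 vcoord_fin vcoord_sigma_additive.

End vcoord_charge.

(* [\int_D f dmu], computed coordinatewise in a basis of E; by linearity the
   result does not depend on the basis. *)
Definition vintegral mu D (f : T -> R) : E :=
  \sum_(i < \dim {:E}) charge_integral (vcoord mu i) D f *: b`_i.

(* [\int_D g dkappa] for a scalar measure kappa and an E-valued g. *)
Definition eintegral (kappa : {measure set T -> \bar R}) D (g : T -> E) : E :=
  \sum_(i < \dim {:E}) Rintegral kappa D (fun x => coord b i (g x)) *: b`_i.

(* [completed_algebra_gen kappa] consists of the sets differing from a
   measurable set by a kappa-negligible one, i.e. the kappa-measurable sets. *)
Definition emeasurable (kappa : {measure set T -> \bar R}) D (g : T -> E) :=
  forall V : set E, eopen dot V -> completed_algebra_gen kappa (D `&` g @^-1` V).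

End vector_measure.

Section generalized_product.
Context {R : realType} {disp1 disp2 : measure_display}.
Context {X : measurableType disp1} {Y : measurableType disp2}.

(* [(kappa \otimes nu_x)(U)] for kappa on D. *)
Definition gprod (kappa : {measure set X -> \bar R}) (D : set X)
    (nu : X -> set Y -> \bar R) (U : set (X * Y)) : \bar R :=
  (\int[kappa]_(x in D) \int[nu x]_y (\1_U (x, y))%:E)%E.

Definition weakstar_measurable {E : vectType R} {dot : {dot E for @idfun R}}
    (kappa : {measure set X -> \bar R}) (D : set X)
    (theta : X -> vmeasure dot Y) :=
  forall B : set Y, measurable B -> emeasurable dot kappa D (fun x => theta x B).

End generalized_product.

(* d-dimensional Lebesgue (outer) measure, via countable covers by boxes. *)
Section lebesgue.
Context {R : realType} {d : nat}.
Implicit Types a b : 'rV[R]_d.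

Definition box a b : set 'rV[R]_d :=
  [set x | forall i, a ord0 i <= x ord0 i <= b ord0 i].

Definition box_volume a b : R :=
  \prod_(i < d) Num.max 0 (b ord0 i - a ord0 i).

(* The predicate P makes finite and empty covers available, which matters
   only for d = 0, where no box is negligible. *)
Definition lebesgue_Rd (A : set 'rV[R]_d) : \bar R :=
  ereal_inf [set s | exists (P : pred nat) (a b : nat -> 'rV[R]_d),
    A `<=` \bigcup_(k in [set k | P k]) box (a k) (b k) /\
    s = (\sum_(k <oo | P k) (box_volume (a k) (b k))%:E)%E].

End lebesgue.

Section torus.
Context (R : realType) (d : nat).

Definition lattice_rel (x y : 'rV[R]_d) : bool :=
  [forall i, (x ord0 i - y ord0 i) \is a Num.int].

Lemma lattice_rel_refl : reflexive lattice_rel.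
Proof. by move=> x; apply/forallP => i; rewrite subrr. Qed.

Lemma lattice_rel_sym : symmetric lattice_rel.
Proof. by move=> x y; apply: eq_forallb => i; rewrite -opprB rpredN. Qed.

Lemma lattice_rel_trans : transitive lattice_rel.
Proof.
move=> y x z /forallP xy /forallP yz; apply/forallP => i.
by rewrite -(subrK (y ord0 i) (x ord0 i)) -addrA rpredD.
Qed.

Canonical lattice_equiv :=
  EquivRel lattice_rel lattice_rel_refl lattice_rel_sym lattice_rel_trans.

Definition torus := quotient_topology {eq_quot lattice_equiv}%qT.
HB.instance Definition _ := PointedTopological.on torus.

Definition torus_pi (x : 'rV[R]_d) : torus := (\pi_({eq_quot lattice_equiv}) x)%qT.

End torus.

(* Measures on Omega and on its closure are represented by Borel measures on
   R^d concentrated there, so the values of theta and Psi outside the closure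
   are irrelevant. *)
Definition two_scale_cvg {R : realType} {d : nat} {E : vectType R}
    {dot : {dot E for @idfun R}} (Omega : set 'rV[R]_d) (eps : nat -> R)
    (mu : nat -> vmeasure dot (borel 'rV[R]_d))
    (kappa : {measure set (borel 'rV[R]_d) -> \bar R})
    (theta : borel 'rV[R]_d -> vmeasure dot (borel (torus R d))) :=
  forall Psi : 'rV[R]_d * torus R d -> R,
    {within closure Omega `*` [set: torus R d], continuous Psi} ->
    ecvg dot
      (fun n => vintegral (mu n) Omega
                  (fun x => Psi (x, torus_pi ((eps n)^-1 *: x))))
      (eintegral kappa (closure Omega)
         (fun x => vintegral (theta x) [set: borel (torus R d)]
                     (fun xi => Psi (x, xi)))).

(* Main.v *)
Require Import Defs.
From HB Require Import structures.
From mathcomp Require Import all_boot all_order all_algebra.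
From mathcomp Require Import all_classical all_reals all_analysis.
From mathcomp Require Import generic_quotient measurable_realfun lra.

Set Implicit Arguments.
Unset Strict Implicit.
Unset Printing Implicit Defensive.

Import Order.TTheory GRing.Theory Num.Theory.
Import numFieldNormedType.Exports.

Local Open Scope classical_set_scope.
Local Open Scope ring_scope.

(**
The measures are discretised before passing to the limit.  For each [n], cut
Omega according to finitely many comparisons of the coordinates of [x] and of
[x / eps n] (mod 1) with rationals, and replace [mu n] by the point masses
[|mu n A|] at points of the cells [A], each carrying the direction
[mu n A / |mu n A|] as an extra feature: total masses stay below the total
variation by its very definition, so no polar decomposition is needed, and
uniform continuity controls the error.  Recording the features
(point, fast variable, direction) by their comparison bits turns the
discretised measures into mass distributions on the binary tree; an ultrafilter
gives a subsequence along which all of them converge.  Splitting an interval in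
the proportions prescribed by the limit tree realises the limit as the image of
Lebesgue measure, without any appeal to Riesz or Caratheodory.  The marginal in
[x] is [kappa]; Radon-Nikodym derivatives with respect to [kappa] of the masses
of the words give, for almost every [x], a conditional tree, and the same
interval splitting turns it into [theta x], which has total variation at most
one because directions have norm at most one.  Hence
[kappa * |theta| <= kappa(closure Omega)], the limit of the discretised masses.
*)

(** * Measurability through finitely many real coordinates *)

(** Vector measures can cancel in the limit, so [theta x] may be strictly smaller than the law of
    (fast variable, direction) behind it. Keeping the direction as a feature makes all masses
    positive; the direction is integrated out only at the end, and cancellation then costs no more
    than an inequality. The unit bound on directions survives the limit because, tested against each
    vector, it is a closed linear condition.

    The liminf bound and the convergence must hold along the same indices. Hence the ultrafilter is
    finer than the filter generated by the sets of large [n] whose total variation is below the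
    liminf plus [r].

    The fast variable is stored as its representative in the closed unit cube, where coordinates can
    be compared; the torus is reached through [torus_pi] afterwards.

    A limit point may sit on a threshold that all its approximants lie below, so its own word can
    differ from the branch leading to it. Words therefore serve only to control distances, and every
    identity between integrals is reached through finite sums and uniform continuity. *)

Lemma coord_open_measurable {disp : measure_display} {S : measurableType disp}
    {R : realType} (I : finType) (D V : set S) (t : I -> S -> R) :
  measurable D -> (forall i, measurable_fun D (t i)) ->
  (forall s, D s -> V s -> exists2 e : R, 0 < e &
     forall s', D s' -> (forall i, `|t i s' - t i s| < e) -> V s') ->
  measurable (D `&` V).
Proof.
move=> mD mt oV.
pose near_q (p : {ffun I -> rat} * nat) (s : S) :=
  forall i, `|t i s - ratr (p.1 i)| < p.2.+1%:R^-1.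
(* Inside [D], the set [V] is the union of the rational cubes contained in it, and there are
   countably many of these; a cube not contained in [V] is replaced by the empty set. *)
pose U p := if pselect (forall s, D s -> near_q p s -> V s)
  then D `&` [set s | near_q p s] else set0.
have mU p : measurable (U p).
  rewrite /U; case: pselect => [h|_] /=; last exact: measurable0.
  rewrite (_ : _ `&` _ = D `&` \bigcap_(i in [set: I])
      (D `&` (t i) @^-1` [set r | `|r - ratr (p.1 i)| < p.2.+1%:R^-1])).
    apply: measurableI => //; apply: fin_bigcap_measurable => // i _.
    apply: mt => //.
    apply: open_measurable.
    rewrite (_ : [set _ | _] = ball (ratr (p.1 i) : R) p.2.+1%:R^-1).
      exact: ball_open.
    by apply/seteqP; split => r /=; rewrite /ball /= distrC.
  apply/seteqP; split => s [Ds] /=; first by move=> sp; split => // i _;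
    split => //; exact: sp.
  by move=> h'; split => // i; have [] := h' i Logic.I.
rewrite (_ : D `&` V = \bigcup_p U p).
  by apply: countable_bigcupT_measurable => //; exact: countableP.
apply/seteqP; split => [s [Ds Vs]|s [p _]]; last first.
  by rewrite /U; case: pselect => // h [Ds sp]; split => //; exact: h.
have [e e0 eV] := oV s Ds Vs.
have [n ne] : exists n : nat, n.+1%:R^-1 < e / 2 :> R.
  exists (Num.trunc (e / 2)^-1); rewrite invf_plt ?posrE ?divr_gt0//.
  exact: truncnS_gt.
have /choice[q hq] : forall i, exists q : rat, `|t i s - ratr q| < n.+1%:R^-1.
  move=> i.
  have n0 : 0 < n.+1%:R^-1 :> R by rewrite invr_gt0.
  move: n0; move: (n.+1%:R^-1) => k k0.
  have [|q] := @rat_in_itvoo R (t i s - k) (t i s + k); first lra.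
  rewrite in_itv/= => /andP[q1 q2]; exists q; rewrite ltr_norml; apply/andP;
    split; lra.
exists ([ffun i => q i], n) => //.
rewrite /U; case: pselect => [h|[]] /=.
  by split => // i; rewrite /= ffunE.
move=> s' Ds' s'q; apply: eV => // i.
have := s'q i; rewrite /= ffunE => h1.
have := hq i.
rewrite (_ : t i s' - t i s = (t i s' - ratr (q i)) - (t i s - ratr (q i)));
  last by lra.
move=> h2; rewrite (le_lt_trans (ler_normB _ _))//.
move: h1 h2 ne; move: (n.+1%:R^-1) => k; lra.
Qed.

Lemma coord_open_measurable_fun {disp : measure_display}
    {S : measurableType disp} {R : realType} (T : ptopologicalType)
    (I : finType) (D : set S) (t : I -> S -> R) (f : S -> T) :
  (forall i, measurable_fun D (t i)) ->
  (forall V s, open V -> D s -> V (f s) -> exists2 e : R, 0 < e &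
     forall s', D s' -> (forall i, `|t i s' - t i s| < e) -> V (f s')) ->
  measurable_fun D (f : S -> borel T).
Proof.
move=> mt fV mD; apply: (@measurability _ _ S (borel T) D f (@open T)) => // _
  [V oV <-].
apply: (coord_open_measurable mD mt) => s Ds Vs; exact: fV.
Qed.

Lemma coord_cts_measurable_fun {disp : measure_display}
    {S : measurableType disp} {R : realType}
    (I : finType) (D : set S) (t : I -> S -> R) (f : S -> R) :
  (forall i, measurable_fun D (t i)) ->
  (forall s (r : R), D s -> 0 < r -> exists2 e : R, 0 < e &
     forall s', D s' -> (forall i, `|t i s' - t i s| < e) -> `|f s' - f s| < r)
       ->
  measurable_fun D f.
Proof.
move=> mt fV mD; apply: (measurability _ (RGenOInfty.measurableE R)) => //.
move=> _ [_ [a ->] <-].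
apply: (coord_open_measurable mD mt) => s Ds /=; rewrite in_itv/= andbT => fa.
have [e e0 es] := fV s (f s - a) Ds ltac:(by rewrite subr_gt0).
exists e => // s' Ds' /(es s' Ds'); rewrite in_itv/= andbT.
by rewrite ltr_norml => /andP[]; lra.
Qed.

(** * Image measures under maps defined on a subset *)

Section domain_law.
Context {d1 d2 : measure_display} {S : measurableType d1} {T : measurableType
  d2}
  {R : realType}.
Variables (m : {measure set S -> \bar R}) (D : set S) (f : S -> T).
Hypotheses (mD : measurable D) (mDy : (m D < +oo)%E) (mf : measurable_fun D f).

(* The hypotheses are arguments so that the measure instances below can be keyed
   on the constant. *)
Definition domain_law & measurable D & (m D < +oo)%E & measurable_fun D f :=
  fun A : set T => m (D `&` f @^-1` A).

Local Notation law := (domain_law mD mDy mf).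

Let law0 : law set0 = 0%E.
Proof. by rewrite /domain_law preimage_set0 setI0 measure0. Qed.

Let law_ge0 A : (0 <= law A)%E.
Proof. exact: measure_ge0. Qed.

Let law_sigma_additive : semi_sigma_additive law.
Proof.
move=> F mF tF mUF; rewrite /domain_law preimage_bigcup setI_bigcupr.
apply: measure_semi_sigma_additive.
- by move=> n; exact: mf.
- apply/trivIsetP => i j _ _ ij; rewrite setIACA setIid -preimage_setI.
  by move/trivIsetP : tF => ->//; rewrite preimage_set0 setI0.
- by rewrite -setI_bigcupr -preimage_bigcup; exact: mf.
Qed.

HB.instance Definition _ :=
  isMeasure.Build _ _ _ law law0 law_ge0 law_sigma_additive.

Let law_finite : fin_num_fun law.
Proof.
move=> U mU; rewrite ge0_fin_numE//; apply: le_lt_trans mDy.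
by rewrite /domain_law le_measure ?inE//; exact: mf.
Qed.

HB.instance Definition _ := Measure_isFinite.Build _ _ _ law law_finite.

Definition domain_finite_law : {finite_measure set T -> \bar R} := law.

End domain_law.

(** * Approximation by finite partitions *)

Section step_approximation.
Context {disp : measure_display} {S : measurableType disp} {R : realType}.
Variable m : {measure set S -> \bar R}.

Lemma bounded_integrable (D : set S) (f : S -> R) (B : R) :
  measurable D -> (m D < +oo)%E -> measurable_fun D f ->
  (forall s, D s -> `|f s| <= B) -> m.-integrable D (EFin \o f).
Proof.
move=> mD mDy mf fB; apply: measurable_bounded_integrable => //.
exists B; split; first exact: num_real.
by move=> M BM s Ds /=; rewrite (le_trans (fB _ Ds))// ltW.
Qed.

Lemma Rintegral_sum (J : finType) (D : set S) (f : J -> S -> R) :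
  measurable D -> (forall j, m.-integrable D (EFin \o f j)) ->
  Rintegral m D (fun s => \sum_j f j s) = \sum_j Rintegral m D (f j).
Proof.
move=> mD fi; rewrite /Rintegral.
under eq_integral do rewrite -sumEFin.
rewrite integral_sum//= -sum_fine//.
by move=> j _; exact: (integrable_fin_num mD (f := EFin \o f j)).
Qed.

Lemma normr_Rintegral_le (D : set S) (f : S -> R) (B : R) :
  measurable D -> (m D < +oo)%E -> measurable_fun D f ->
  (forall s, D s -> `|f s| <= B) -> `|Rintegral m D f| <= B * fine (m D).
Proof.
move=> mD mDy mf fB; rewrite -Rintegral_cst//.
apply: le_trans (le_normr_Rintegral _ _) _ => //;
  first exact: bounded_integrable fB.
apply: le_Rintegral => //.
- apply: (@bounded_integrable _ _ B) => //; first exact: measurableT_comp.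
  by move=> s Ds; rewrite normr_id fB.
- apply: (@bounded_integrable _ _ `|B|) => //.
Qed.

(** The weight [h] stays inside the cell integrals and only [f] is replaced by its step values; [h]
    may thus be a signed density. *)
Lemma Rintegral_step (J : finType) (D : set S) (W : S -> J) (f h : S -> R)
    (c : J -> R) (r B : R) :
  measurable D -> (m D < +oo)%E ->
  (forall j, measurable (D `&` W @^-1` [set j])) ->
  measurable_fun D f -> measurable_fun D h ->
  (forall s, D s -> `|h s| <= B) -> 
  (forall s, D s -> `|f s - c (W s)| <= r) ->
  `|Rintegral m D (fun s => f s * h s) -
    \sum_j c j * Rintegral m (D `&` W @^-1` [set j]) h| <= r * B * fine (m D).
Proof.
move=> mD mDy mW mf mh hB fc.
pose g j s := c j * (h s * \1_(D `&` W @^-1` [set j]) s).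
have mg j : measurable_fun D (fun s => h s * \1_(D `&` W @^-1` [set j]) s).
  by apply: measurable_funM => //; exact: measurable_indic.
have ig' j : m.-integrable D (EFin \o (fun s => h s * \1_(D `&` W @^-1` [set
  j]) s)).
  apply: (@bounded_integrable _ _ B) => // s Ds; rewrite normrM.
  by rewrite indicE; case: (_ \in _); rewrite ?normr1 ?mulr1 ?normr0 ?mulr0
    ?hB// (le_trans _ (hB s Ds)).
have ig j : m.-integrable D (EFin \o g j).
  apply: (@bounded_integrable _ _ (`|c j| * B)) => //.
    exact: measurable_funM.
  move=> s Ds; rewrite normrM ler_wpM2l// normrM.
  by rewrite indicE; case: (_ \in _); rewrite ?normr1 ?mulr1 ?normr0 ?mulr0
    ?hB// (le_trans _ (hB s Ds)).
have -> : \sum_j c j * Rintegral m (D `&` W @^-1` [set j]) h =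
    Rintegral m D (fun s => \sum_j g j s).
  rewrite Rintegral_sum//; apply: eq_bigr => j _.
  rewrite RintegralZl//; congr (_ * _).
  rewrite Rintegral_mkcondr; apply: eq_Rintegral => s /set_mem Ds.
  rewrite patchE indicE in_setI (mem_set Ds)/=.
  by case: (_ \in _); rewrite ?mulr1 ?mulr0.
have gE s : D s -> \sum_j g j s = c (W s) * h s.
  move=> Ds; rewrite (bigD1 (W s))//= big1 ?addr0.
    by rewrite /g indicE mem_set ?mulr1//.
  by move=> j jW; rewrite /g indicE memNset ?mulr0// => -[_ /= /esym/eqP];
    rewrite (negbTE jW).
have mgg : measurable_fun D (fun s => \sum_j g j s).
  by apply: measurable_sum => j; exact: measurable_funM.
have cB j : `|c j| <= \sum_j `|c j| by rewrite (bigD1 j)//= lerDl sumr_ge0.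
rewrite -RintegralB//; last 2 first.
  apply: (@bounded_integrable _ _ ((r + \sum_j `|c j|) * B)) => //.
    exact: measurable_funM.
  move=> s Ds; rewrite normrM ler_pM// ?hB//.
  rewrite -(subrK (c (W s)) (f s)) (le_trans (ler_normD _ _))// lerD// fc//.
  apply: (@bounded_integrable _ _ ((\sum_j `|c j|) * B)) => //.
  by move=> s Ds; rewrite gE// normrM ler_pM// ?hB.
apply: normr_Rintegral_le => //.
  by apply: measurable_funB => //; exact: measurable_funM.
by move=> s Ds; rewrite gE// -mulrBl normrM ler_pM ?fc ?hB.
Qed.

Lemma measure_step (J : finType) (D : set S) (W : S -> J) (f : S -> R)
    (c : J -> R) (r : R) :
  measurable D -> (m D < +oo)%E ->
  (forall j, measurable (D `&` W @^-1` [set j])) ->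
  measurable_fun D f -> (forall s, D s -> `|f s - c (W s)| <= r) ->
  `|Rintegral m D f - \sum_j c j * fine (m (D `&` W @^-1` [set j]))|
    <= r * fine (m D).
Proof.
move=> mD mDy mW mf fc.
have := @Rintegral_step J D W f (cst 1) c r 1 mD mDy mW mf _ _ fc.
rewrite mulr1 => /(_ _ _); under eq_Rintegral do rewrite mulr1.
under eq_bigr do rewrite Rintegral_cst// mul1r.
by apply => // s _; rewrite normr1.
Qed.

End step_approximation.

(** The error is [r] times the mass on [D] of both Jordan parts. The hypothesis on disjoint pairs,
    applied to the two halves of [D] in the Hahn decomposition, bounds this mass by [V]. *)
Lemma charge_integral_step {disp : measure_display} {T : measurableType disp}
    {R : realType} (nu : {charge set T -> \bar R}) (J : finType) (D : set T)
    (W : T -> J) (f : T -> R) (c : J -> R) (r V : R) :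
  measurable D -> (forall j, measurable (D `&` W @^-1` [set j])) ->
  measurable_fun D f -> 0 <= r -> (forall s, D s -> `|f s - c (W s)| <= r) ->
  (forall A B, measurable A -> measurable B -> A `<=` D -> B `<=` D ->
     A `&` B = set0 -> `|fine (nu A)| + `|fine (nu B)| <= V) ->
  `|charge_integral nu D f - \sum_j c j * fine (nu (D `&` W @^-1` [set j]))|
    <= r * V.
Proof.
move=> mD mW mf r0 fc hV; rewrite /charge_integral.
set PN := projT2 _; move: PN; set P := _.1; set N := _.2 => PN.
have [[mP posP] [mN negN] _ PN0] := PN.
have pE A : measurable A -> jordan_pos PN A = nu (A `&` P).
  by move=> mA; rewrite jordan_posE cjordan_posE /crestr0 mem_set.
have nE A : measurable A -> jordan_neg PN A = (- nu (A `&` N))%E.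
  by move=> mA; rewrite jordan_negE cjordan_negE /crestr0 mem_set.
have pfin : (jordan_pos PN D < +oo)%E by rewrite ltey_eq fin_num_measure.
have nfin : (jordan_neg PN D < +oo)%E by rewrite ltey_eq fin_num_measure.
have h1 := measure_step mD pfin mW mf fc.
have h2 := measure_step mD nfin mW mf fc.
have -> : \sum_j c j * fine (nu (D `&` W @^-1` [set j])) =
    \sum_j c j * fine (jordan_pos PN (D `&` W @^-1` [set j])) -
    \sum_j c j * fine (jordan_neg PN (D `&` W @^-1` [set j])).
  rewrite -sumrB; apply: eq_bigr => j _; rewrite -mulrBr; congr (_ * _).
  rewrite (jordan_decomp PN)//= /cadd/= cscaleN1/= fineB//;
    exact: fin_num_measure.
have e (a b c' d' : R) : a - b - (c' - d') = (a - c') - (b - d') by lra.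
rewrite e.
apply: le_trans (ler_normB _ _) _.
apply: le_trans (lerD h1 h2) _.
rewrite -mulrDr ler_wpM2l//.
apply: le_trans (hV (D `&` P) (D `&` N) _ _ _ _ _) => //.
- have p1 : fine (jordan_pos PN D) <= `|fine (nu (D `&` P))|.
    by rewrite pE// ler_norm.
  have p2 : fine (jordan_neg PN D) <= `|fine (nu (D `&` N))|.
    by rewrite nE// fineN -normrN ler_norm.
  exact: lerD p1 p2.
- exact: measurableI.
- exact: measurableI.
- by rewrite setIACA setIid PN0 setI0.
Qed.

Lemma eq_of_dist_le {R : realFieldType} (K x y : R) :
  (forall r, 0 < r -> `|x - y| <= r * K) -> x = y.
Proof.
move=> h; apply/eqP; rewrite -subr_eq0 -normr_eq0; apply/negPn/negP => xy.
have xy0 : 0 < `|x - y| by rewrite lt_neqAle eq_sym xy normr_ge0.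
have [K0|K0] := leP K 0.
  by have := h 1 ltr01; rewrite mul1r leNgt (le_lt_trans K0).
have := h (`|x - y| / K / 2) ltac:(by rewrite !divr_gt0).
rewrite mulrAC divfK ?gt_eqF//; lra.
Qed.

Lemma value_partition {disp : measure_display} {T : measurableType disp}
    {R : realType} (f : T -> R) (C r : R) :
  measurable_fun [set: T] f -> (forall t, `|f t| <= C) -> 0 < r ->
  exists (K : nat) (W : T -> 'I_K.+1) (c : 'I_K.+1 -> R),
    (forall j, measurable (W @^-1` [set j])) /\
    (forall t, `|f t - c (W t)| <= r).
Proof.
(* The range [[-C, C]] is cut into slabs of length [r]: the index of [t] is the integer part of
   [g t], and [c] gives the lower end of the slab. *)
move=> mf fC r0; pose g t := (f t + C) / r.
have g0 t : 0 <= g t.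
  by apply: divr_ge0; [have := fC t; rewrite ler_norml; lra|exact: ltW].
pose K := Num.trunc (2 * C / r).
have gK t : (Num.trunc (g t) < K.+1)%N.
  rewrite ltnS; apply: le_truncn; rewrite /g ler_pM2r ?invr_gt0//.
  by have := fC t; rewrite ler_norml; lra.
have WE t (j : 'I_K.+1) : (inord (Num.trunc (g t)) == j :> 'I_K.+1) =
    (j%:R <= g t < j.+1%:R).
  by rewrite -truncn_eq// -val_eqE/= inordK.
exists K, (fun t => inord (Num.trunc (g t))), (fun j => j%:R * r - C).
split => [j|t].
  rewrite (_ : _ @^-1` _ = [set: T] `&` f @^-1` `[j%:R * r - C, j.+1%:R * r -
    C[%classic).
    exact: mf.
  rewrite setTI; apply/seteqP; split => t /=; rewrite in_itv/=.
    move=> /eqP; rewrite WE /g ler_pdivlMr// ltr_pdivrMr// => /andP[h1 h2].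
    apply/andP; split; lra.
  move=> /andP[h1 h2]; apply/eqP; rewrite WE /g ler_pdivlMr// ltr_pdivrMr//.
  apply/andP; split; lra.
set j := inord _; have /eqP := erefl j; rewrite {1}/j WE /g.
rewrite ler_pdivlMr// ltr_pdivrMr// => /andP[h1].
rewrite -natr1 mulrDl mul1r => h2; rewrite ler_norml; apply/andP; split; lra.
Qed.

(** Both sides are close to the same finite sum over the level slabs of [f], which gives the change
    of variables for a signed density. *)
Lemma charge_integral_density {d1 d2 : measure_display}
    {S : measurableType d1} {T : measurableType d2} {R : realType}
    (m : {measure set S -> \bar R}) (G : set S) (phi : S -> T) (h : S -> R)
    (nu : {charge set T -> \bar R}) (f : T -> R) (B C : R) :
  measurable G -> (m G < +oo)%E -> measurable_fun G phi ->
  measurable_fun G h -> 0 <= B -> (forall s, G s -> `|h s| <= B) ->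
  (forall A, measurable A -> nu A = (Rintegral m (G `&` phi @^-1` A) h)%:E) ->
  measurable_fun [set: T] f -> (forall t, `|f t| <= C) ->
  charge_integral nu [set: T] f = Rintegral m G (fun s => f (phi s) * h s).
Proof.
move=> mG mGy mphi mh B0 hB nuE mf fC.
have mP A : measurable A -> measurable (G `&` phi @^-1` A) by exact: mphi.
(* The first summand bounds [nu] on a pair of disjoint sets, each contributing at most
   [B * fine (m G)]; the second is the error of [Rintegral_step]. *)
apply: (@eq_of_dist_le _ (2 * (B * fine (m G)) + B * fine (m G))) => r r0.
have [K [W [c [mW fc]]]] := value_partition mf fC r0.
have h1 := @charge_integral_step _ _ _ nu _ setT W f c r (2 * (B * fine (m G)))
  measurableT _ mf (ltW r0) (fun s _ => fc s) _.
have h2 := @Rintegral_step _ _ _ m _ G (W \o phi) (f \o phi) h c r B mG mGy _ _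
  mh hB (fun s _ => fc _).
have e (a b c' : R) : a - b = (a - c') - (b - c') by lra.
rewrite (e _ _ (\sum_j c j * fine (nu ([set: T] `&` W @^-1` [set j])))).
apply: le_trans (ler_normB _ _) _; rewrite mulrDr; apply: lerD.
  apply: h1; first by move=> j; rewrite setTI.
  have nuB A : measurable A -> `|fine (nu A)| <= B * fine (m G).
    move=> mA; rewrite nuE//=.
    apply: le_trans (@normr_Rintegral_le _ _ _ m _ h B (mP _ mA) _ _ _) _.
    - by rewrite (le_lt_trans _ mGy)// le_measure ?inE//; exact: mP.
    - by apply: measurable_funS mh.
    - by move=> s [Gs _]; exact: hB.
    - rewrite ler_wpM2l// fine_le ?ge0_fin_numE//.
      + by rewrite (le_lt_trans _ mGy)// le_measure ?inE//; exact: mP.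
      + by rewrite le_measure ?inE//; exact: mP.
  by move=> A A' mA mA' _ _ _; have := nuB _ mA; have := nuB _ mA'; lra.
rewrite mulrA; under eq_bigr do rewrite nuE ?setTI//=.
apply: h2; first by move=> j; exact: (mP _ (mW j)).
by apply: (measurableT_comp mf).
Qed.

(** * The Euclidean norm and vector measures dominated by a finite measure *)

Section enorm_theory.
Context {R : realType} {E : vectType R} (dot : {dot E for @idfun R}).

Lemma enorm_ge0 (v : E) : 0 <= enorm dot v.
Proof. exact: sqrtr_ge0. Qed.

Lemma enorm_sqr (v : E) : enorm dot v ^+ 2 = dot v v.
Proof. by rewrite sqr_sqrtr// dot_ge0. Qed.

Lemma enorm0 : enorm dot 0 = 0.
Proof. by rewrite /enorm linear0r sqrtr0. Qed.

Lemma enorm_eq0 (v : E) : enorm dot v = 0 -> v = 0.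
Proof.
move=> v0; apply/eqP; apply: contraT => vn0.
have : 0 < dot v v by exact: neq0_dnorm_gt0.
by rewrite -enorm_sqr v0 expr0n ltxx.
Qed.

Lemma enormZ (a : R) (v : E) : enorm dot (a *: v) = `|a| * enorm dot v.
Proof.
rewrite /enorm linearZl_LR linearZr_LR /= mulrA -expr2 sqrtrM ?sqr_ge0//.
by rewrite sqrtr_sqr.
Qed.

Lemma enormN (v : E) : enorm dot (- v) = enorm dot v.
Proof. by rewrite -scaleN1r enormZ normrN1 mul1r. Qed.

Lemma enormD (u v : E) : enorm dot (u + v) <= enorm dot u + enorm dot v.
Proof.
rewrite -(@ler_pXn2r _ 2) ?nnegrE ?addr_ge0 ?enorm_ge0//.
rewrite enorm_sqr linearDl !linearDr /= (dotC _ v u) sqrrD !enorm_sqr.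
by have := le_trans (ler_norm _) (dot_le_enorm dot u v); lra.
Qed.

Lemma enorm_sum (I : finType) (u : I -> E) :
  enorm dot (\sum_i u i) <= \sum_i enorm dot (u i).
Proof.
elim/big_ind2 : _ => [|x a y b xa yb|//]; first by rewrite enorm0.
by apply: le_trans (enormD _ _) _; exact: lerD.
Qed.

(** Finite additivity suffices: the value on the union of all but the first [n] sets has norm at
    most the [tau]-mass of that remainder, which tends to zero since [tau] is finite. *)
Lemma vmeasure_dominated {disp : measure_display} {T : measurableType disp}
    (tau : {finite_measure set T -> \bar R}) (Theta : set T -> E) :
  (forall A B, measurable A -> measurable B -> A `&` B = set0 ->
     Theta (A `|` B) = Theta A + Theta B) ->
  (forall A, measurable A -> enorm dot (Theta A) <= fine (tau A)) ->
  exists v : vmeasure dot T, forall A, v A = Theta A.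
Proof.
move=> ThetaU Thetale.
have Theta0 : Theta set0 = 0.
  apply: enorm_eq0; apply/eqP; rewrite eq_le enorm_ge0 andbT.
  by rewrite (le_trans (Thetale _ _))// measure0.
suff sa : forall F : nat -> set T,
    (forall k, measurable (F k)) -> trivIset [set: nat] F ->
    ecvg dot (fun n => \sum_(k < n) Theta (F k)) (Theta (\bigcup_k F k)).
  by exists (VMeasure Theta0 sa).
move=> F mF tF.
have mU n : measurable (\bigcup_(k in `I_n) F k).
  exact: bigcup_measurable.
have mUF : measurable (\bigcup_k F k) by exact: bigcupT_measurable.
have disjF n : (\bigcup_(k in `I_n) F k) `&` F n = set0.
  apply/seteqP; split => // t [[k /= kn Fkt] Fnt].
  have /trivIsetP/(_ k n Logic.I Logic.I (negbT (ltn_eqF kn))) := tF.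
  by rewrite -subset0 => /(_ t); apply.
have IS n : \bigcup_(k in `I_n.+1) F k = \bigcup_(k in `I_n) F k `|` F n.
  by rewrite !bigcup_mkord big_ord_recr.
have UE n : Theta (\bigcup_(k in `I_n) F k) = \sum_(k < n) Theta (F k).
  elim: n => [|n IH]; first by rewrite II0 bigcup_set0 big_ord0.
  by rewrite IS ThetaU// IH big_ord_recr.
have tauE n : fine (tau (\bigcup_(k in `I_n) F k)) = \sum_(k < n) fine (tau (F
  k)).
  elim: n => [|n IH]; first by rewrite II0 bigcup_set0 big_ord0 measure0.
  by rewrite IS measureU// fineD ?fin_num_measure// IH big_ord_recr.
pose rest n := (\bigcup_k F k) `\` (\bigcup_(k in `I_n) F k).
have mrest n : measurable (rest n) by exact: measurableD.
have restE n : \bigcup_k F k = \bigcup_(k in `I_n) F k `|` rest n.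
  by rewrite setDUK//; exact: bigcup_subset.
have restI n : \bigcup_(k in `I_n) F k `&` rest n = set0.
  by rewrite /rest setDE setICA setICr setI0.
apply: (@squeeze_cvgr _ _ _ _ (cst 0)
  (fun n => fine (tau (\bigcup_k F k)) - \sum_(k < n) fine (tau (F k)))).
- apply: nearW => n; rewrite enorm_ge0/=.
  have -> : Theta (\bigcup_k F k) = \sum_(k < n) Theta (F k) + Theta (rest n).
    by rewrite -UE -ThetaU// -restE.
  rewrite opprD addrA subrr sub0r enormN.
  apply: le_trans (Thetale _ (mrest n)) _.
  have -> : fine (tau (\bigcup_k F k)) =
      \sum_(k < n) fine (tau (F k)) + fine (tau (rest n)).
    by rewrite -tauE -fineD ?fin_num_measure// -measureU// -restE.
  by rewrite addrAC subrr add0r.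
- exact: cvg_cst.
- suff h : (\sum_(k < n) fine (tau (F k)))%R @[n --> \oo] -->
      fine (tau (\bigcup_k F k)).
    by have := cvgB (cvg_cst (fine (tau (\bigcup_k F k)))) h; rewrite subrr;
      exact.
  have : (\sum_(0 <= k < n) tau (F k))%E @[n --> \oo] -->
      (fine (tau (\bigcup_k F k)))%:E.
    rewrite fineK ?fin_num_measure//; exact: measure_semi_sigma_additive.
  move=> /fine_cvg; apply: cvg_trans; apply: near_eq_cvg; apply: nearW => n.
  by rewrite /= -(big_mkord xpredT (fun k => fine (tau (F k)))) sum_fine// => i
    _; rewrite fin_num_measure.
Qed.

End enorm_theory.

(** * Words, trees and decoding *)

Section comparison_bits.
Context {R : realType} (I : finType).
Implicit Types z : I -> R.

(* [unpickle] enumerates all comparisons [z i < q]. *)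
Definition fbit z (k : nat) : bool :=
  if unpickle k is Some p then z (p : I * rat).1 < ratr p.2 else false.

Definition fword z (k : nat) : seq bool := mkseq (fbit z) k.

Lemma size_fword z k : size (fword z k) = k.
Proof. exact: size_mkseq. Qed.

Lemma take_fword z j k : (j <= k)%N -> take j (fword z k) = fword z j.
Proof. by move=> jk; rewrite /fword /mkseq -map_take take_iota (minn_idPl jk).
  Qed.

(** Long enough words contain the comparisons with all points of a grid of mesh less than [r]
    covering [[-M, M]]; two values more than [r] apart are separated by a grid point. *)
Lemma fword_close (M r : R) : 0 < r -> exists K : nat,
  forall z z', (forall i, `|z i| <= M) -> (forall i, `|z' i| <= M) ->
    fword z K = fword z' K -> forall i, `|z i - z' i| <= r.
Proof.
move=> r0; pose n := Num.trunc r^-1.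
have nr : n.+1%:R^-1 < r.
  by rewrite invf_plt ?posrE//; exact: truncnS_gt.
(* The second successor gives [|M| * n.+1 + 1 < m], so that the grid point just above any value in
   [[-M, M]] still has an index at most [m + m]. *)
pose m := (Num.trunc (`|M| * n.+1%:R)).+2.
pose q (j : 'I_(m + m).+1) : rat := (j%:R - m%:R) / n.+1%:R.
pose K := (\max_(p : I * 'I_(m + m).+1) (pickle (p.1, q p.2)).+1)%N.
exists K => z z' zM z'M zz'.
have key i j : (z i < ratr (q j)) = (z' i < ratr (q j)).
  pose k := pickle (i, q j).
  have kK : (k < K)%N by exact: (@leq_bigmax _ (fun p => (pickle (p.1, q
    p.2)).+1) (i, j)).
  have : nth false (fword z K) k = nth false (fword z' K) k by rewrite zz'.
  by rewrite !nth_mkseq// /fbit /k pickleK.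
have sep (x y : R) : `|x| <= M -> r < y - x -> exists j, x < ratr (q j) <= y.
  move=> xM xy.
  have n0 : 0 < n.+1%:R :> R by [].
  have M0 : 0 <= M by exact: le_trans xM.
  have mM : `|M| * n.+1%:R + 1 < m%:R.
    by rewrite /m -[m in _ < m]natr1 ltrD2r; exact: truncnS_gt.
  rewrite (ger0_norm M0) in mM.
  have xn : `|x * n.+1%:R| <= M * n.+1%:R by rewrite normrM (ger0_norm (ltW
    n0)) ler_wpM2r// ltW.
  pose t := x * n.+1%:R + m%:R + 1.
  have t0 : 0 <= t by move: xn; rewrite ler_norml /t; lra.
  have tm : (Num.trunc t < (m + m).+1)%N.
    rewrite truncn_lt_nat// -natr1 natrD /t.
    by move: xn; rewrite ler_norml; lra.
  exists (Ordinal tm); have /andP[t1] := truncn_itv t0.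
  rewrite -natr1 => t2.
  rewrite /q /= fmorph_div/= rmorphB/= !ratr_nat ltr_pdivlMr// ler_pdivrMr//.
  apply/andP; split; first by rewrite /t in t2; lra.
  have : r * n.+1%:R < (y - x) * n.+1%:R by rewrite ltr_pM2r.
  have : 1 < r * n.+1%:R by rewrite -ltr_pdivrMr// div1r.
  by rewrite /t in t1; lra.
move=> i; rewrite leNgt; apply/negP.
have [zz|zz] := leP (z i) (z' i).
  rewrite distrC ger0_norm ?subr_ge0// => /(sep _ _ (zM i))[j] /andP[h1 h2].
  by move: h1; rewrite key ltNge h2.
rewrite ger0_norm ?subr_ge0 ?ltW// => /(sep _ _ (z'M i))[j] /andP[h1 h2].
by move: h1; rewrite -key ltNge h2.
Qed.

End comparison_bits.

Section splitting_tree.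
Context {R : realType}.
Implicit Types (L : seq bool -> R) (u : R) (w : seq bool).

Definition consistent L := (forall w, 0 <= L w) /\
  (forall w, L w = L (rcons w false) + L (rcons w true)).

(* Left endpoint of the cell of [w] when `[0, L [::][ is split recursively, the
   subcell of [rcons w false] being on the left. *)
Definition tleft L w : R := \sum_(0 <= i < size w)
  if nth false w i then L (rcons (take i w) false) else 0.

Fixpoint tpath L u (k : nat) : seq bool :=
  if k is j.+1 then
    let w := tpath L u j in rcons w (tleft L w + L (rcons w false) <= u)
  else [::].

Lemma size_tpath L u k : size (tpath L u k) = k.
Proof. by elim: k => //= k IH; rewrite size_rcons IH. Qed.

Lemma take_tpath L u j k : (j <= k)%N -> take j (tpath L u k) = tpath L u j.
Proof.
elim: k => [|k IH]; first by rewrite leqn0 => /eqP ->.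
rewrite leq_eqVlt => /orP[/eqP ->|]; first by rewrite take_oversize//
  size_tpath.
rewrite ltnS => jk /=; rewrite -cats1 take_cat size_tpath.
have [jk'|kj] := ltnP j k; first exact: IH.
have -> : j = k by apply/eqP; rewrite eqn_leq jk.
by rewrite subnn take0 cats0.
Qed.

Lemma tleft_rcons L w b : tleft L (rcons w b) =
  tleft L w + if b then L (rcons w false) else 0.
Proof.
rewrite /tleft size_rcons big_nat_recr//= nth_rcons ltnn eqxx; congr (_ + _).
  apply: eq_big_nat => i /andP[_ iw].
  by rewrite nth_rcons iw -(cats1 w b) takel_cat// ltnW.
by rewrite -(cats1 w b) take_cat ltnn subnn take0 cats0.
Qed.

(** Cells are half-open, in accordance with the [<=] in [tpath]: a common endpoint belongs to the
    right-hand cell, so the cells of each depth partition the root interval. *)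
Lemma tpathP L u w : consistent L -> 0 <= u < L [::] ->
  (tpath L u (size w) == w) = (tleft L w <= u < tleft L w + L w).
Proof.
move=> [L0 LU] u0; elim/last_ind : w => [|w b IH].
  by rewrite /tleft/= big_nil add0r u0.
rewrite size_rcons /= eqseq_rcons IH tleft_rcons.
have [wu|] := boolP (tleft L w <= u < _); rewrite ?andTb.
  move: IH; rewrite wu => /eqP ->; move: wu; rewrite (LU w) => /andP[w1 w2].
  case: b => /=.
    by rewrite addrA in w2; rewrite eqb_id w2 andbT.
  by rewrite addr0 w1/= eqbF_neg ltNge.
rewrite (LU w) andFb => /negP wu; apply/esym/negP => /andP[h1 h2]; apply: wu.
have := L0 (rcons w false); have := L0 (rcons w true).
by case: b h1 h2 => ? ? ? ?; apply/andP; split; lra.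
Qed.

Lemma tleft_bounds L w : consistent L ->
  0 <= tleft L w /\ tleft L w + L w <= L [::].
Proof.
move=> [L0 LU]; elim/last_ind : w => [|w b [IH1 IH2]].
  by rewrite /tleft/= big_nil add0r.
rewrite tleft_rcons; have := LU w.
have := L0 (rcons w false); have := L0 (rcons w true).
by case: b => ? ? ?; split; lra.
Qed.

Lemma tcell_itv L w : consistent L ->
  `[0, L [::][%classic `&` [set u | tpath L u (size w) = w] =
  `[tleft L w, tleft L w + L w[%classic.
Proof.
move=> cL; have [h1 h2] := tleft_bounds w cL.
apply/seteqP; split => u /=; rewrite !in_itv/=.
  by move=> [u0 /eqP]; rewrite tpathP.
move=> /andP[h3 h4].
have u0 : 0 <= u < L [::] by apply/andP; split; lra.
by split => //; apply/eqP; rewrite tpathP// h3.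
Qed.

Lemma tcell_measure L w : consistent L ->
  lebesgue_measure (`[0, L [::][%classic `&` [set u | tpath L u (size w) = w]) =
  (L w)%:E.
Proof.
move=> cL; rewrite tcell_itv// lebesgue_measure_itv/= lte_fin.
case: ifPn => [_|]; first by rewrite -EFinD addrAC subrr add0r.
by rewrite -leNgt => h; have := cL.1 w => h2; congr EFin; lra.
Qed.

(** The half-open cell of the path contains [u], hence is not empty. Paths thus visit only words of
    positive mass, which is what makes them branches through inhabited words. *)
Lemma tcell_pos L u k : consistent L -> 0 <= u < L [::] -> 0 < L (tpath L u k).
Proof.
move=> cL u0; have := tpathP (tpath L u k) cL u0.
by rewrite size_tpath eqxx => /esym/andP[]; lra.
Qed.

Context {disp : measure_display} {S : measurableType disp}.
Variable L : S -> seq bool -> R.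
Hypothesis cL : forall s, consistent (L s).
Hypothesis mL : forall w, measurable_fun [set: S] (L ^~ w).

(** The region under the graph of the root mass; its section at [s] is the interval that is split
    according to [L s]. *)
Definition tdomain : set (S * measurableTypeR R) := [set p | 0 <= p.2 < L p.1
  [::]].

Let measurable_left w : measurable_fun [set: S] (fun s => tleft (L s) w).
Proof.
apply: measurable_sum => i; case: nth; [exact: mL|exact: measurable_cst].
Qed.

Let measurable_le (f g : S * measurableTypeR R -> R) : measurable_fun setT f ->
  measurable_fun setT g -> measurable [set p | f p <= g p].
Proof. by move=> mf mg; rewrite -[X in measurable X]setTI;
  exact: measurable_fun_le. Qed.

Let measurable_lt (f g : S * measurableTypeR R -> R) : measurable_fun setT f ->
  measurable_fun setT g -> measurable [set p | f p < g p].
Proof.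
move=> mf mg; rewrite (_ : [set _ | _] = ~` [set p | g p <= f p]).
  by apply: measurableC; exact: measurable_le.
by apply/seteqP; split => p /=; rewrite ltNge => /negP.
Qed.

Lemma measurable_tdomain : measurable tdomain.
Proof.
rewrite (_ : tdomain = [set p | (cst 0 p : R) <= p.2] `&` [set p | p.2 < L p.1
  [::]]).
  apply: measurableI; first exact: measurable_le.
  apply: measurable_lt => //.
  exact: (measurableT_comp (mL _)).
by apply/seteqP; split => p /=; [move=> /andP[]|move=> [? ?]; apply/andP].
Qed.

Lemma measurable_tcell w :
  measurable (tdomain `&` [set p | tpath (L p.1) p.2 (size w) = w]).
Proof.
rewrite (_ : _ `&` _ = tdomain `&` ([set p | tleft (L p.1) w <= p.2] `&`
    [set p | p.2 < tleft (L p.1) w + L p.1 w])).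
  apply: measurableI; first exact: measurable_tdomain.
  apply: measurableI; first apply: measurable_le => //.
    exact: (measurableT_comp (measurable_left _)).
  apply: measurable_lt => //; apply: measurable_funD.
    exact: (measurableT_comp (measurable_left _)).
  exact: (measurableT_comp (mL _)).
apply/seteqP; split => p /= [Dp].
  by move=> /eqP; rewrite tpathP// => /andP[].
by move=> [h1 h2]; split => //; apply/eqP; rewrite tpathP// h1.
Qed.

End splitting_tree.

Section decoding.
Context {R : realType} (I : finType) (P : set (I -> R)) (M : R).
Hypothesis PM : forall z, P z -> forall i, `|z i| <= M.

Definition inhabited_word (w : seq bool) :=
  exists z, P z /\ fword z (size w) = w.

(* The value [cst 0] for words without a point in [P] is never used. *)
Definition word_rep (w : seq bool) : I -> R :=
  if pselect (inhabited_word w) is left h then projT1 (cid h) else cst 0.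

Lemma word_repP w : inhabited_word w ->
  P (word_rep w) /\ fword (word_rep w) (size w) = w.
Proof.
by move=> h; rewrite /word_rep; case: pselect => // h'; case: cid.
Qed.

Definition branch (p : nat -> seq bool) := [/\ forall k, size (p k) = k,
  forall j k, (j <= k)%N -> take j (p k) = p j & forall k, inhabited_word (p
    k)].

Lemma branch_rep p k : branch p -> P (word_rep (p k)) /\
  forall j, (j <= k)%N -> fword (word_rep (p k)) j = p j.
Proof.
move=> [sp tp ip]; have [Pk wk] := word_repP (ip k); split => // j jk.
by rewrite sp in wk; rewrite -(take_fword _ jk) wk tp.
Qed.

Lemma word_rep_close (r : R) : 0 < r -> exists K, forall p q, branch p ->
  branch q -> p K = q K -> forall j k i, (K <= j)%N -> (K <= k)%N ->
  `|word_rep (p j) i - word_rep (q k) i| <= r.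
Proof.
move=> r0; have [K hK] := @fword_close R I M r r0; exists K.
move=> p q bp bq pq j k i Kj Kk.
have [Pj wj] := branch_rep j bp; have [Pk wk] := branch_rep k bq.
apply: hK; [exact: PM|exact: PM|].
by rewrite wj// wk.
Qed.

(** A limit of representatives, taken coordinatewise. Its own words need not be those of [p]: a
    strict comparison [z i < q] true along the branch can become an equality in the limit. *)
Definition decode (p : nat -> seq bool) (i : I) : R :=
  lim (word_rep (p k) i @[k --> \oo]).

Lemma decode_cvg p i : branch p ->
  word_rep (p k) i @[k --> \oo] --> decode p i.
Proof.
move=> bp; apply/cauchy_cvgP/cauchy_exP => r r0 /=.
have [K hK] := word_rep_close (divr_gt0 r0 (ltr0Sn R 1)).
exists (word_rep (p K) i); exists K => // k /= Kk.
rewrite /ball /=.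
by apply: le_lt_trans (hK p p bp bp erefl K k i _ Kk) _ => //; lra.
Qed.

Lemma decode_close (r : R) : 0 < r -> exists K, forall p, branch p ->
  forall k i, (K <= k)%N -> `|word_rep (p k) i - decode p i| <= r.
Proof.
move=> r0; have [K hK] := word_rep_close r0; exists K => p bp k i Kk.
have h : `|word_rep (p k) i - word_rep (p j) i| @[j --> \oo] -->
    `|word_rep (p k) i - decode p i|.
  by apply: cvg_norm; apply: cvgB; [exact: cvg_cst|exact: decode_cvg].
rewrite -(cvg_lim (@Rhausdorff R) h); apply: limr_le.
  by apply/cvg_ex; eexists; exact: h.
by exists K => // j /= Kj; exact: hK.
Qed.

End decoding.

(** An ultrafilter finer than the sets of large [n] with [v n < l + r] gives all the limits at once.
    Each of its members being nonempty, a [k]-th index can be chosen that handles the first [k]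
    words within [1 / (k + 1)]; countability of [T] then gives convergence for every word. *)
Lemma bounded_diagonal_subsequence {R : realType} (T : countType)
    (v : nat -> R) (l : R) (a : nat -> T -> R) (C : R) :
  (forall n w, `|a n w| <= C) ->
  (forall N r, 0 < r -> exists n, (N <= n)%N /\ v n < l + r) ->
  exists (phi : nat -> nat) (L : T -> R), [/\ {homo phi : m n / (m < n)%N},
    forall k, v (phi k) < l + k.+1%:R^-1 &
    forall w, a (phi k) w @[k --> \oo] --> L w].
Proof.
move=> aC vl.
pose F : set_system nat := filter_from [set p : nat * R | 0 < p.2]
  (fun p => [set n | (p.1 <= n)%N /\ v n < l + p.2]).
have FF : ProperFilter F.
  apply: filter_from_proper; last first.
    by move=> p p0; have [n hn] := vl p.1 _ p0; exists n.
  apply: filter_from_filter; first by exists (0, 1) => /=.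
  move=> [N r] [N' r'] /= r0 r0'; exists (maxn N N', Num.min r r') => /=.
    by rewrite lt_min r0.
  move=> n /=; rewrite geq_max => -[/andP[h1 h2] h3].
  have : Num.min r r' <= r by rewrite ge_min lexx.
  have : Num.min r r' <= r' by rewrite ge_min lexx orbT.
  by move=> h4 h5; split; split => //; lra.
have [U [UU FU]] := ultraFilterLemma FF.
have UF : ProperFilter U by exact: ultra_proper.
(* Compactness of [[-C, C]] gives a cluster point of the image ultrafilter, and a cluster point of
   an ultrafilter is a limit: otherwise the complement of some neighbourhood would belong to it. *)
have lim_ex w : exists l, forall r, 0 < r -> U [set n | `|a n w - l| < r].
  have aU : ((a ^~ w) @ U) `[- C, C]%classic.
    by apply: nearW => n /=; rewrite in_itv/= -ler_norml.
  have [p [_ pcl]] := @segment_compact R (- C) C ((a ^~ w) @ U) _ aU.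
  exists p => r r0; have [//|UC] := in_ultra_setVsetC [set n | `|a n w - p| <
    r] UU.
  have [x [/= x1 x2]] := pcl [set x | ~ `|x - p| < r] (ball p r) UC
    (nbhsx_ballx _ _ r0).
  by exfalso; apply: x1; rewrite distrC.
have [L hL] := choice lim_ex.
have Uall k : U [set n | forall w, (pickle w < k)%N -> forall r : R, r =
  k.+1%:R^-1 ->
    `|a n w - L w| < r].
  have : forall j r, 0 < r -> U [set n | forall w, (pickle w < j)%N -> `|a n w
    - L w| < r].
    elim=> [|j IH] r r0; first by apply: nearW.
    case e : (@unpickle T j) => [w0|].
      apply: filterS2 (IH r r0) (hL w0 r r0) => n h1 h2 w;
        rewrite ltnS leq_eqVlt.
      move=> /orP[/eqP wj|]; last exact: h1.
      by move: e; rewrite -wj pickleK => -[->].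
    apply: filterS (IH r r0) => n h1 w; rewrite ltnS leq_eqVlt => /orP[/eqP
      wj|].
      by move: e; rewrite -wj pickleK.
    exact: h1.
  move=> /(_ k k.+1%:R^-1) h; apply: filterS (h _) => [n h1 w wk r ->|];
    first exact: h1.
  by rewrite invr_gt0.
have next k N : exists n, [/\ (N < n)%N, v n < l + k.+1%:R^-1 &
    forall w, (pickle w < k)%N -> `|a n w - L w| < k.+1%:R^-1].
  have UN : U [set n | (N.+1 <= n)%N /\ v n < l + k.+1%:R^-1].
    by apply: FU; exists (N.+1, k.+1%:R^-1) => //=; rewrite invr_gt0.
  have [n [[h1 h2] h3]] := filter_ex (filterI UN (Uall k)).
  by exists n; split => // w wk; exact: h3.
have [g hg] := choice (fun p : nat * nat => next p.1 p.2).
pose phi := fix phi k := if k is j.+1 then g (j.+1, phi j) else g (0%N, 0%N).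
have phiP k : v (phi k) < l + k.+1%:R^-1 /\
    forall w, (pickle w < k)%N -> `|a (phi k) w - L w| < k.+1%:R^-1.
  by case: k => [|k]; [have [] := hg (0, 0)%N|have [] := hg (k.+1, phi k)].
exists phi, L; split.
- apply: (homo_ltn ltn_trans) => k /=; by have [] := hg (k.+1, phi k).
- by move=> k; have [] := phiP k.
- move=> w; apply/cvgrPdist_lt => r r0.
  near=> k; rewrite distrC.
  have [_ /(_ w)] := phiP k; move=> h; apply: lt_trans (h _) _.
    by near: k; exact: nbhs_infty_gt.
  by near: k; exact: (near_infty_natSinv_lt (PosNum r0)).
Unshelve. all: by end_near. Qed.

Lemma limn_einf_frequently {R : realType} (v : nat -> \bar R) (C : R) :
  (forall n, (0 <= v n <= C%:E)%E) ->
  exists2 l : R, limn_einf v = l%:E &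
    forall N r, 0 < r -> exists n, (N <= n)%N /\ fine (v n) < l + r.
Proof.
move=> vC.
have vfin n : v n \is a fin_num.
  by have /andP[h1 h2] := vC n; rewrite ge0_fin_numE// (le_lt_trans h2)// ltry.
have lE : limn_einf v = ereal_sup (range (einfs v)).
  by rewrite limn_einf_lim; apply/cvg_lim => //; exact: cvg_einfs_sup.
have lfin : limn_einf v \is a fin_num.
  rewrite ge0_fin_numE lE.
    apply: (@le_lt_trans _ _ C%:E); last exact: ltry.
    apply: ge_ereal_sup => _ [n _ <-].
    apply: (@le_trans _ _ (v n)); last by have /andP[] := vC n.
    by apply: ereal_inf_lbound; exists n => /=.
  apply: (@le_trans _ _ (einfs v 0%N)); last by apply: ereal_sup_ubound;
    exists 0%N.
  by apply: le_ereal_inf_tmp => _ [n _ <-]; have /andP[] := vC n.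
exists (fine (limn_einf v)); first by rewrite fineK.
move=> N r r0.
have : (einfs v N < (fine (limn_einf v) + r)%:E)%E.
  apply: (@le_lt_trans _ _ (limn_einf v)).
    by rewrite lE; apply: ereal_sup_ubound; exists N.
  by rewrite EFinD fineK// lteDl// lte_fin.
move=> /ereal_inf_lt[_ [n /= Nn <-]] h; exists n; split => //.
by rewrite -lte_fin fineK.
Qed.

(** * Topology and measurability by coordinates and by words *)

Lemma open_coordP {R : realType} {d : nat} (V : set 'rV[R]_d) (y : 'rV[R]_d) :
  open V -> V y -> exists2 e : R, 0 < e &
    forall y' : 'rV[R]_d, (forall i, `|y' ord0 i - y ord0 i| < e) -> V y'.
Proof.
move=> oV Vy; have /nbhs_ballP[e /= e0 eV] := open_nbhs_nbhs (conj oV Vy).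
exists e => // y' yy'; apply: eV; rewrite /ball/=; split => // i j.
by rewrite (ord1 i); apply: le_lt_trans (yy' j); rewrite distrC.
Qed.

Lemma closed_coordP {R : realType} {d : nat} (K : set 'rV[R]_d) (y : 'rV[R]_d) :
  closed K -> (forall e : R, 0 < e -> exists2 y', K y' &
    forall i, `|y' ord0 i - y ord0 i| < e) -> K y.
Proof.
move=> cK h; apply: contrapT => Ky.
have [e e0 eK] := open_coordP (closed_openC cK) Ky.
by have [y' Ky' /eK] := h e e0.
Qed.

Lemma measurable_row_coord {R : realType} {d : nat} (i : 'I_d) :
  measurable_fun [set: borel 'rV[R]_d] (fun y => y ord0 i).
Proof.
move=> _; apply: (measurability _ (RGenOInfty.measurableE R)) => //.
move=> _ [_ [a ->] <-]; rewrite setTI; apply: sub_sigma_algebra.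
rewrite openE => y /=; rewrite in_itv/= andbT => ay.
apply/nbhs_ballP; exists (y ord0 i - a) => /=; first by rewrite subr_gt0.
move=> y' [_ /(_ ord0 i)]; rewrite /ball/= => h; rewrite in_itv/= andbT.
by move: h; rewrite ltr_norml => /andP[]; lra.
Qed.

Lemma measurable_finite_valued {disp : measure_display}
    {S : measurableType disp} {R : realType} (J : finType) (D : set S)
    (W : S -> J) (g : J -> R) :
  (forall j, measurable (D `&` W @^-1` [set j])) -> measurable_fun D (g \o W).
Proof.
move=> mW _ Y mY.
rewrite (_ : _ `&` _ = \bigcup_(j in [set j | Y (g j)]) (D `&` W @^-1` [set
  j])).
  apply: fin_bigcup_measurable => //; exact: finite_finset.
apply/seteqP; split => s /=; first by move=> [Ds Ys]; exists (W s).
by move=> [j Yj [Ds /= Wj]]; split => //; rewrite Wj.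
Qed.

(** Turns words of length [k] into elements of a finite type that can index sums and partitions; the
    default is met only for words of another length. *)
Definition word_tuple (k : nat) (w : seq bool) : k.-tuple bool :=
  insubd (nseq_tuple k false) w.

Lemma val_word_tuple k w : size w = k -> val (word_tuple k w) = w.
Proof. by move=> wk; rewrite /word_tuple insubdK// -topredE/= wk. Qed.

Lemma word_tuple_eq k w (t : k.-tuple bool) : size w = k ->
  (word_tuple k w = t) = (w = t).
Proof.
move=> wk; apply/propext; split => [<-|wt]; first by rewrite val_word_tuple.
by apply: val_inj; rewrite val_word_tuple.
Qed.

Lemma measurable_fword {disp : measure_display} {S : measurableType disp}
    {R : realType} (I : finType) (D : set S) (z : S -> I -> R) (k : nat)
    (w : seq bool) :
  measurable D -> (forall i, measurable_fun D (fun s => z s i)) ->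
  measurable (D `&` [set s | fword (z s) k = w]).
Proof.
move=> mD mz; elim: k w => [|k IH] w.
  have [->|w0] := eqVneq w [::]; last by rewrite (_ : [set _ | _] = set0)
    ?setI0//;
    apply/seteqP; split => // s /= /esym/eqP; rewrite (negbTE w0).
  by rewrite (_ : [set _ | _] = setT) ?setIT//; apply/seteqP; split.
have mb b : measurable (D `&` [set s | fbit (z s) k = b]).
  have mt : measurable (D `&` [set s | fbit (z s) k]).
    rewrite /fbit; case: unpickle => [[i q]|/=];
      last by rewrite set_false setI0.
    rewrite (_ : _ `&` _ = D `&` (fun s => z s i) @^-1` `]-oo, ratr q[%classic).
      exact: mz.
    by apply/seteqP; split => s /= [Ds]; rewrite in_itv.
  case: b => //; rewrite (_ : _ `&` _ = D `\` (D `&` [set s | fbit (z s) k])).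
    exact: measurableD.
  apply/seteqP; split => s /= [Ds].
    by move=> /negbT/negP h; split => // -[].
  by move=> h; split => //; apply/negbTE/negP => ?; apply: h.
case: (lastP w) => [|w' b].
  by rewrite (_ : [set _ | _] = set0) ?setI0//; apply/seteqP; split.
rewrite (_ : _ `&` _ = (D `&` [set s | fword (z s) k = w']) `&`
    (D `&` [set s | fbit (z s) k = b])); first exact: measurableI.
apply/seteqP; split => s /=; rewrite /fword mkseqS.
  by move=> [Ds /rcons_inj[-> ->]].
by move=> [[Ds ->] [_ ->]].
Qed.

(** The coordinate is a pointwise limit of functions of the first [k] letters of the path, each
    taking finitely many values. *)
Lemma measurable_decode {disp : measure_display} {S : measurableType disp}
    {R : realType} (I : finType) (P : set (I -> R)) (M : R) (D : set S)
    (p : S -> nat -> seq bool) (i : I) :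
  (forall z, P z -> forall i, `|z i| <= M) ->
  (forall s, D s -> branch P (p s)) ->
  (forall s k, size (p s k) = k) ->
  (forall w, measurable (D `&` [set s | p s (size w) = w])) ->
  measurable_fun D (fun s => decode P (p s) i).
Proof.
move=> PM bp sp mp.
apply: (@measurable_fun_cvg _ _ _ _ (fun k s => word_rep P (p s k) i));
  last first.
  by move=> s Ds; exact: (decode_cvg PM (bp s Ds)).
move=> k.
have -> : (fun s => word_rep P (p s k) i) =
    (fun t : k.-tuple bool => word_rep P t i) \o (fun s => word_tuple k (p s
      k)).
  by apply/funext => s /=; rewrite val_word_tuple.
apply: measurable_finite_valued => t.
rewrite (_ : _ @^-1` _ = [set s | p s (size t) = t]); first exact: mp.
by apply/funext => s /=; rewrite word_tuple_eq// size_tuple.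
Qed.

Lemma density_ae_unique {disp : measure_display} {S : measurableType disp}
    {R : realType} (kappa : {measure set S -> \bar R}) (f g : S -> R) :
  kappa.-integrable [set: S] (EFin \o f) -> measurable_fun [set: S] g ->
  (forall A, measurable A -> (\int[kappa]_(x in A) (f x)%:E =
     \int[kappa]_(x in A) (g x)%:E)%E) ->
  kappa.-negligible [set x | f x != g x].
Proof.
move=> fi mg fg.
have : ae_eq kappa setT (EFin \o f) (EFin \o g).
  apply: integral_ae_eq => //; first exact/measurable_EFinP.
  by move=> A _ mA; exact: fg.
apply: negligibleS => x /= fgx h.
by have [/eqP] := h Logic.I; rewrite (negbTE fgx).
Qed.

Lemma product_unit_finite {disp : measure_display} {X : measurableType disp}
    {R : realType} (kappa : {finite_measure set X -> \bar R})
    (G : set (X * measurableTypeR R)) :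
  measurable G -> (forall p, G p -> 0 <= p.2 < 1) ->
  ((kappa \x @lebesgue_measure R)%E G < +oo)%E.
Proof.
move=> mG G01.
apply: (@le_lt_trans _ _ ((kappa \x @lebesgue_measure R)%E
    (setT `*` `[0%R, 1%R[%classic))).
  apply: le_measure; rewrite ?inE//; first by apply: measurableX => //;
    exact: measurable_itv.
  by move=> p Gp; split => //=; rewrite in_itv/= G01.
rewrite product_measure1E//= lebesgue_measure_itv/= lte_fin ltr01 oppr0 adde0
  mule1.
by rewrite ltey_eq fin_num_measure.
Qed.

(** * Compactness and disintegration of discrete measures *)

Section compactness_disintegration.
Context {R : realType} {d : nat} (Iq : finType).
Variables (K : set 'rV[R]_d) (Q : set (Iq -> R)) (M C l : R).
Variables (J : nat -> finType) (a : forall n, J n -> R)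
  (x : forall n, J n -> 'rV[R]_d) (q : forall n, J n -> Iq -> R) (v : nat -> R).
Hypothesis closedK : closed K.
Hypothesis KM : forall y, K y -> forall i, `|y ord0 i| <= M.
Hypothesis closedQ : forall s : Iq -> R, (forall e : R, 0 < e ->
  exists2 s', Q s' & forall i, `|s' i - s i| <= e) -> Q s.
Hypothesis QM : forall s, Q s -> forall i, `|s i| <= M.
Hypothesis a_ge0 : forall n (j : J n), 0 <= a j.
Hypothesis a_gt0 : forall n (j : J n), 0 < a j -> K (x j) /\ Q (q j).
Hypothesis av : forall n, \sum_(j : J n) a j <= v n.
Hypothesis vC : forall n, v n <= C.
Hypothesis vl : forall N r, 0 < r -> exists n, (N <= n)%N /\ v n < l + r.

Local Notation I := ('I_d + Iq)%type.
Local Notation X := (borel 'rV[R]_d).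
Local Notation U := (measurableTypeR R).
Local Notation leb := (@lebesgue_measure R).

Let join (y : 'rV[R]_d) (s : Iq -> R) (i : I) : R :=
  match i with inl i => y ord0 i | inr i => s i end.
Let xpart (z : I -> R) : 'rV[R]_d := \row_i z (inl i).
Let qpart (z : I -> R) : Iq -> R := fun i => z (inr i).
Let P : set (I -> R) := [set z | K (xpart z) /\ Q (qpart z)].

Let xpart_join y s : xpart (join y s) = y.
Proof. by apply/rowP => i; rewrite mxE. Qed.

Let PM z : P z -> forall i, `|z i| <= M.
Proof.
move=> [Kz Qz] [i|i]; last exact: (QM Qz i).
by have := KM Kz i; rewrite mxE.
Qed.

Let z n (j : J n) : I -> R := join (x j) (q j).

Let Pz n (j : J n) : 0 < a j -> P (z j).
Proof. by move=> /a_gt0[Kj Qj]; split => //; rewrite xpart_join. Qed.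

Let weight n (w : seq bool) : R :=
  \sum_(j : J n | fword (z j) (size w) == w) a j.

Let weight_ge0 n w : 0 <= weight n w.
Proof. exact: sumr_ge0. Qed.

Let weight_le n w : weight n w <= v n.
Proof.
apply: le_trans (av n); rewrite [leRHS](bigID (fun j : J n => fword (z j) (size
  w) == w))/=.
by rewrite lerDl sumr_ge0.
Qed.

Let weightU n w : weight n w = weight n (rcons w false) + weight n (rcons w
  true).
Proof.
rewrite /weight !size_rcons (bigID (fun j : J n => fbit (z j) (size w)))/=
  addrC.
congr (_ + _); apply: eq_bigl => j;
  by rewrite /fword mkseqS eqseq_rcons; case: fbit.
Qed.

Let weight_gt0 n w : 0 < weight n w -> inhabited_word P w.
Proof.
move=> w0; apply: contrapT => h; move: w0; rewrite /weight big1 ?ltxx// => j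
  /eqP wj.
apply/eqP; rewrite eq_le a_ge0 andbT leNgt; apply/negP => aj.
by apply: h; exists (z j); split => //; exact: Pz.
Qed.

(** Additivity, positivity and the mass bound pass to the limit. Positive limit mass of [w] forces
    positive weight at some index, hence an atom of [P] whose word begins with [w]. *)
Lemma limit_tree : exists (phi : nat -> nat) (L : seq bool -> R),
  [/\ {homo phi : m n / (m < n)%N}, consistent L, L [::] <= l,
      forall w, 0 < L w -> inhabited_word P w &
      forall w, weight (phi k) w @[k --> \oo] --> L w].
Proof.
have [|phi [L [hphi vphi Lcv]]] :=
    @bounded_diagonal_subsequence R (seq bool) v l weight C _ vl.
  by move=> n w; rewrite ger0_norm// (le_trans (weight_le n w)).
exists phi, L; split => //.
- split=> [w|w].
    rewrite -(cvg_lim (@Rhausdorff R) (Lcv w)); apply: limr_ge.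
      by apply/cvg_ex; eexists; exact: Lcv.
    exact: nearW.
  apply: (@cvg_unique _ (@Rhausdorff R) _ _ _ _ (Lcv w)).
  apply: cvg_trans (cvgD (Lcv (rcons w false)) (Lcv (rcons w true))).
  by apply: near_eq_cvg; apply: nearW => k; rewrite weightU.
- apply/ler_addgt0Pr => r r0.
  rewrite -(cvg_lim (@Rhausdorff R) (Lcv [::])); apply: limr_le.
    by apply/cvg_ex; eexists; exact: Lcv.
  near=> k; apply: le_trans (weight_le _ _) _; apply: le_trans (ltW (vphi k)) _.
  rewrite lerD2l; apply: ltW; near: k.
  exact: (near_infty_natSinv_lt (PosNum r0)).
- move=> w Lw; apply: contrapT => h.
  have w0 n : weight n w = 0.
    apply/eqP; rewrite eq_le weight_ge0 andbT leNgt; apply/negP => /weight_gt0.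
    exact: h.
  move: Lw; rewrite (_ : L w = 0) ?ltxx//.
  rewrite -(cvg_lim (@Rhausdorff R) (Lcv w)).
  by rewrite (_ : (fun k => weight (phi k) w) = cst 0) ?lim_cst//; apply/funext.
Unshelve. all: by end_near. Qed.

Let unif_cts (H : 'rV[R]_d -> (Iq -> R) -> R) :=
  forall r : R, 0 < r -> exists2 e : R, 0 < e & forall y y' s s',
    K y -> K y' -> Q s -> Q s' -> (forall i, `|y ord0 i - y' ord0 i| <= e) ->
    (forall i, `|s i - s' i| <= e) -> `|H y s - H y' s'| <= r.

(** This is where [K] and [Q] must be closed: the representatives lie in [P], and the decoded point
    is only their limit. *)
Let P_decode p : branch P p -> P (decode P p).
Proof.
move=> bp; split.
  apply: closed_coordP => // e e0.
  have [k hk] := decode_close PM (divr_gt0 e0 (ltr0Sn R 1)).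
  have [[Kk _] _] := branch_rep k bp.
  exists (xpart (word_rep P (p k))) => // i; rewrite !mxE.
  apply: le_lt_trans (hk p bp k (inl i) (leqnn _)) _; lra.
apply: closedQ => e e0; have [k hk] := decode_close PM e0.
have [[_ Qk] _] := branch_rep k bp.
by exists (qpart (word_rep P (p k))) => // i; exact: hk.
Qed.

Let measurable_integrand {disp : measure_display} {S : measurableType disp}
    (D : set S) (y : S -> 'rV[R]_d) (s : S -> Iq -> R) H :
  (forall i, measurable_fun D (fun t => y t ord0 i)) ->
  (forall i, measurable_fun D (s ^~ i)) ->
  (forall t, D t -> K (y t)) -> (forall t, D t -> Q (s t)) ->
  unif_cts H -> measurable_fun D (fun t => H (y t) (s t)).
Proof.
move=> my ms Ky Qs HU.
apply: (@coord_cts_measurable_fun _ _ _ I D (fun i t => join (y t) (s t) i)).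
  by case=> i /=; [exact: my|exact: ms].
move=> t r Dt r0; have [e e0 he] := HU (r / 2) ltac:(by rewrite divr_gt0).
exists e => // t' Dt' tt'.
have : `|H (y t') (s t') - H (y t) (s t)| <= r / 2.
  by apply: he; [exact: Ky|exact: Ky|exact: Qs|exact: Qs| |] => i; apply: ltW;
    [exact: (tt' (inl i))|exact: (tt' (inr i))].
lra.
Qed.

Section limit_space.
Variables (phi : nat -> nat) (L : seq bool -> R).
Hypothesis cL : consistent L.
Hypothesis L_inhabited : forall w, 0 < L w -> inhabited_word P w.
Hypothesis L_cvg : forall w, weight (phi k) w @[k --> \oo] --> L w.

Let D0 : set U := `[0, L [::][%classic.

Let branch_tpath u : D0 u -> branch P (tpath L u).
Proof.
rewrite /D0/= in_itv/= => u0; split; first exact: size_tpath.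
  by move=> j k; exact: take_tpath.
by move=> k; apply: L_inhabited; exact: tcell_pos.
Qed.

Let mD0 : measurable D0. Proof. exact: measurable_itv. Qed.

Let leb_D0 : leb D0 = (L [::])%:E.
Proof.
rewrite -(tcell_measure [::] cL); congr (leb _).
by apply/seteqP; split => u /=; [move=> ?; split|case].
Qed.

Let leb_D0y : (leb D0 < +oo)%E. Proof. by rewrite leb_D0 ltry. Qed.

Let cell w : set U := D0 `&` [set u | tpath L u (size w) = w].

Let mcell w : measurable (cell w).
Proof. by rewrite /cell /D0 tcell_itv//; exact: measurable_itv. Qed.

Let leb_cell w : leb (cell w) = (L w)%:E. Proof. exact: tcell_measure. Qed.

Let leb_celly w : (leb (cell w) < +oo)%E. Proof. by rewrite leb_cell ltry. Qed.

Let z1 (u : U) : I -> R := decode P (tpath L u).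
Let x1 (u : U) : X := xpart (z1 u).
Let q1 (u : U) : Iq -> R := qpart (z1 u).

Let mz1 i : measurable_fun D0 (z1 ^~ i).
Proof.
by apply: (@measurable_decode _ U _ I P M D0 (tpath L) i PM) => // s k;
  exact: size_tpath.
Qed.

Let mx1i (i : 'I_d) : measurable_fun D0 (fun u => x1 u ord0 i).
Proof. by have := mz1 (inl i); congr measurable_fun; apply/funext => u;
  rewrite mxE. Qed.

Let mx1 : measurable_fun D0 x1.
Proof.
apply: (coord_open_measurable_fun mx1i) => V s oV Ds Vs.
have [e e0 eV] := open_coordP oV Vs.
by exists e => // s' _ /eV.
Qed.

Let P1 u : D0 u -> P (z1 u).
Proof. by move=> /branch_tpath; exact: P_decode. Qed.

Let cell_preimage (k : nat) (t : k.-tuple bool) :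
  D0 `&` (fun u => word_tuple k (tpath L u k)) @^-1` [set t] = cell t.
Proof.
by congr (_ `&` _); apply/funext => u /=; rewrite word_tuple_eq ?size_tpath//
  size_tuple.
Qed.

Let measurable_H1 H : unif_cts H -> measurable_fun D0 (fun u : U => H (x1 u)
  (q1 u)).
Proof.
move=> HU; apply: measurable_integrand => //.
- by move=> i; exact: (mz1 (inr i)).
- by move=> u /P1[].
- by move=> u /P1[].
Qed.

(** Both the sum and the integral are compared with sums over the words of one fixed length [k],
    where [H] takes its value at the representative of the word. These are finite sums, so
    convergence of each [weight] is enough. *)
Lemma weighted_sums_cvg H : unif_cts H ->
  \sum_(j : J (phi n)) a j * H (x j) (q j) @[n --> \oo] -->
  Rintegral leb D0 (fun u => H (x1 u) (q1 u)).
Proof.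
move=> HU; have mH1 := measurable_H1 HU; apply/cvgrPdist_le => r r0.
have C0 : 0 <= C by apply: le_trans (vC 0); apply: le_trans (av 0);
  exact: sumr_ge0.
have L0C : L [::] <= C.
  rewrite -(cvg_lim (@Rhausdorff R) (@L_cvg [::])); apply: limr_le.
    by apply/cvg_ex; eexists; exact: L_cvg.
  by apply: nearW => n; exact: le_trans (weight_le _ _) _.
(* Error budget: [r' * C] for replacing the integral, [r' * C] for replacing the atoms, and [r'] for
   the convergence of the finite sum. *)
pose r' := r / (2 * C + 1).
have r'0 : 0 < r' by rewrite divr_gt0//; lra.
have r'E : r' * C + r' * C + r' = r.
  have -> : r' * C + r' * C + r' = r' * (2 * C + 1) by lra.
  by rewrite divfK//; apply: lt0r_neq0; lra.
have [e e0 he] := HU r' r'0.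
have [k1 hk1] := @fword_close R I M e e0.
have [k2 hk2] := decode_close PM e0.
pose k := maxn k1 k2.
pose ct (t : seq bool) := H (xpart (word_rep P t)) (qpart (word_rep P t)).
have near_rep (y : I -> R) (t : seq bool) : P y -> inhabited_word P t ->
    (forall i, `|y i - word_rep P t i| <= e) ->
    `|H (xpart y) (qpart y) - ct t| <= r'.
  move=> [Ky Qy] /word_repP[[Kt Qt] _] yt.
  by apply: he => // i; rewrite ?mxE; exact: yt.
have step1 : `|Rintegral leb D0 (fun u => H (x1 u) (q1 u)) -
    \sum_(t : k.-tuple bool) ct t * L t| <= r' * C.
  have h : `|Rintegral leb D0 (fun u => H (x1 u) (q1 u)) -
      \sum_(t : k.-tuple bool) ct t * fine (leb
        (D0 `&` (fun u => word_tuple k (tpath L u k)) @^-1` [set t]))|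
      <= r' * fine (leb D0).
    apply: measure_step => //.
    - by move=> t; rewrite cell_preimage; exact: (mcell t).
    - move=> u Du; rewrite val_word_tuple ?size_tpath//.
      apply: near_rep; [exact: P1| |].
        by have [_ _] := branch_tpath Du; exact.
      by move=> i; rewrite distrC; apply: hk2;
        [exact: branch_tpath|exact: leq_maxr].
  move: h; rewrite leb_D0; under eq_bigr do rewrite cell_preimage leb_cell.
  by move=> h; apply: le_trans h _; rewrite ler_wpM2l// ltW.
have step2 n : `|\sum_(j : J n) a j * H (x j) (q j) -
    \sum_(t : k.-tuple bool) ct t * weight n t| <= r' * C.
  have -> : \sum_(t : k.-tuple bool) ct t * weight n t =
      \sum_(j : J n) a j * ct (fword (z j) k).
    rewrite /weight; under eq_bigr do rewrite big_mkcond mulr_sumr.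
    rewrite exchange_big/=; apply: eq_bigr => j _.
    rewrite (bigD1 (word_tuple k (fword (z j) k)))//= big1 ?addr0.
      by rewrite size_tuple val_word_tuple ?size_fword// eqxx mulrC.
    move=> t /eqP tj; rewrite size_tuple; case: ifPn => [/eqP h|];
      last by rewrite mulr0.
    by exfalso; apply: tj; apply/esym; rewrite word_tuple_eq ?size_fword.
  rewrite -sumrB; apply: le_trans (ler_norm_sum _ _ _) _.
  apply: (@le_trans _ _ (\sum_(j : J n) r' * a j)); last first.
    rewrite -mulr_sumr; apply: ler_wpM2l; [exact: ltW|exact: le_trans (av n)
      (vC n)].
  apply: ler_sum => j _; rewrite -mulrBr normrM (ger0_norm (a_ge0 j)) mulrC.
  (* An atom of zero mass may lie outside [P], where nothing is known about [H]; it contributes zero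
     to both sums. *)
  have [a0|a0] := leP (a j) 0.
    have -> : a j = 0 by apply/eqP; rewrite eq_le a_ge0 a0.
    by rewrite !mulr0.
  rewrite ler_wpM2r// -[x j](xpart_join _ (q j)).
  have iw : inhabited_word P (fword (z j) k).
    by exists (z j); split; [exact: Pz|rewrite size_fword].
  apply: (near_rep (z j)) => //; first exact: Pz.
  have [Pr wr] := word_repP iw; rewrite size_fword in wr.
  apply: hk1; [exact/PM/Pz|exact: PM|].
  by rewrite -(take_fword _ (leq_maxl k1 k2)) -[RHS](take_fword _ (leq_maxl k1
    k2)) -/k wr.
have step3 : \sum_(t : k.-tuple bool) ct t * weight (phi n) t @[n --> \oo] -->
    \sum_(t : k.-tuple bool) ct t * L t.
  apply: cvg_big => [|t _]; first exact: add_continuous.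
  by apply: cvgM; [exact: cvg_cst|exact: L_cvg].
move/cvgrPdist_le : step3 => /(_ r' r'0); apply: filterS => n h3.
have tri (s1 s2 s3 s4 : R) : `|s1 - s4| <= `|s1 - s2| + `|s2 - s3| + `|s4 - s3|.
  rewrite (_ : s1 - s4 = (s1 - s2) + (s2 - s3) - (s4 - s3)); last by lra.
  by apply: le_trans (ler_normB _ _) _; rewrite lerD2r ler_normD.
apply: le_trans (tri _ (\sum_(t : k.-tuple bool) ct t * L t)
  (\sum_(t : k.-tuple bool) ct t * weight (phi n) t) _) _.
have -> : r = r' * C + r' + r' * C by rewrite -r'E addrAC.
exact: lerD (lerD step1 h3) (step2 _).
Qed.

Let kappa : {finite_measure set X -> \bar R} := domain_finite_law mD0 leb_D0y
  mx1.

Let kappaE A : kappa A = leb (D0 `&` x1 @^-1` A). Proof. by []. Qed.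

Let mx1_cell w : measurable_fun (cell w) x1.
Proof. by apply: (measurable_funS mD0 _ mx1); exact: subIsetl. Qed.

(** The part of [kappa] carried by the paths through [w]; its density is the conditional probability
    of [w] given the slow variable. *)
Let rho w : {finite_measure set X -> \bar R} :=
  domain_finite_law (mcell w) (leb_celly w) (@mx1_cell w).

Let rhoE w A : rho w A = leb (cell w `&` x1 @^-1` A). Proof. by []. Qed.

Let mcellI w A : measurable A -> measurable (cell w `&` x1 @^-1` A).
Proof. by move=> mA; exact: mx1_cell. Qed.

Let cell_nil : cell [::] = D0.
Proof. by apply/seteqP; split => u /=; [case|move=> ?; split]. Qed.

Let cell_rcons w b : cell (rcons w b) =
  cell w `&` [set u | (tleft L w + L (rcons w false) <= u) = b].
Proof.
apply/seteqP; split => u /=; rewrite /cell/= size_rcons/=.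
  by move=> [Du /rcons_inj[wu]]; rewrite !wu => ub; split.
by move=> [[Du wu]]; rewrite !wu => ->.
Qed.

Let rhoU w A : measurable A ->
  rho w A = (rho (rcons w false) A + rho (rcons w true) A)%E.
Proof.
move=> mA; rewrite !rhoE.
have -> : cell w `&` x1 @^-1` A = (cell (rcons w false) `&` x1 @^-1` A) `|`
    (cell (rcons w true) `&` x1 @^-1` A).
  rewrite -setIUl !cell_rcons -setIUr; congr (_ `&` _).
  apply/seteqP; split => u /=; last by case=> -[].
  by move=> cu; split => //; case: (_ <= u); [right|left].
apply: measureU; [exact: mcellI|exact: mcellI|].
rewrite !cell_rcons; apply/seteqP; split => // u.
by move=> [[[_ /= h1] _] [[_ /= h2] _]]; rewrite h1 in h2.
Qed.

Let densities : exists g : seq bool -> X -> R, forall w,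
  [/\ forall y, 0 <= g w y, kappa.-integrable [set: X] (EFin \o g w) &
      forall A, measurable A -> rho w A = (\int[kappa]_(y in A) (g w y)%:E)%E].
Proof.
suff h w : exists g : X -> R, [/\ forall y, 0 <= g y,
    kappa.-integrable [set: X] (EFin \o g) &
    forall A, measurable A -> rho w A = (\int[kappa]_(y in A) (g y)%:E)%E].
  by have [g gP] := choice h; exists g.
have dom : rho w `<< kappa.
  apply/null_content_dominatesP => A mA A0.
  have h : (leb (cell w `&` x1 @^-1` A) <= leb (D0 `&` x1 @^-1` A))%E.
    apply: le_measure; rewrite ?inE; [exact: mcellI|exact: mx1|].
    by apply: setSI; exact: subIsetl.
  have A0' : leb (D0 `&` x1 @^-1` A) = 0%E := A0.
  by rewrite A0' in h; apply/eqP; rewrite eq_le measure_ge0 andbT; exact: h.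
have [f [f0 ffin fi fE]] := radon_nikodym_sigma_finite dom.
have fg : f = EFin \o (fine \o f) by apply/funext => y /=; rewrite fineK.
exists (fine \o f); split.
- by move=> y; rewrite fine_ge0.
- by rewrite -fg.
- by move=> A mA; rewrite fE//; apply: eq_integral => y _ /=; rewrite fineK.
Qed.

Let mK : measurable (K : set X).
Proof.
rewrite -(setCK K); apply: measurableC; apply: sub_sigma_algebra.
exact: closed_openC.
Qed.

Let kappaK : kappa (~` K) = 0%E.
Proof.
rewrite kappaE (_ : _ `&` _ = set0) ?measure0//.
by apply/seteqP; split => // u [/P1[]].
Qed.

Let kappaT : (kappa setT <= (L [::])%:E)%E.
Proof. by rewrite kappaE preimage_setT setIT leb_D0. Qed.

Let measurable_neq (f g : X -> R) : measurable_fun setT f ->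
  measurable_fun setT g -> measurable [set y | f y != g y].
Proof.
move=> mf mg; rewrite (_ : [set _ | _] = ~` ((f \- g) @^-1` [set 0])).
  apply: measurableC; rewrite -[X in measurable X]setTI.
  by apply: (measurable_funB mf mg) => //; exact: measurable_set1.
by apply/seteqP; split => y /=; rewrite -subr_eq0 => /eqP.
Qed.

(* On the null set where the densities fail to be consistent the tree is set to
   zero, so that no path exists there and all later statements hold everywhere.
     *)
Let conditional_tree : exists F : X -> seq bool -> R,
  [/\ forall y, consistent (F y), forall w, measurable_fun setT (F ^~ w),
      forall w A, measurable A ->
        (\int[kappa]_(y in A) (F y w)%:E = leb (cell w `&` x1 @^-1` A))%E &
      forall y w, 0 < F y w -> [/\ K y, inhabited_word P w & F y [::] = 1]].
Proof.
have [g gP] := densities.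
have mg w : measurable_fun [set: X] (g w).
  by have [_ /integrableP[/measurable_EFinP]] := gP w.
(* The exceptional sets: [B1] where the densities are not additive at [w], [B2] where a word of zero
   mass has nonzero density, [B3] where the root density is not one. Excluding [B2] makes positive
   conditional mass imply [0 < L w], hence an inhabited word. *)
pose B1 w := [set y | g w y != g (rcons w false) y + g (rcons w true) y].
pose B2 w := if L w == 0 then [set y | g w y != 0] else set0.
pose B3 := [set y | g [::] y != 1].
pose B w := B1 w `|` B2 w `|` B3 `|` ~` K.
have mB w : measurable (B w).
  apply: measurableU; last exact: measurableC.
  apply: measurableU; last exact: measurable_neq.
  apply: measurableU; first by apply: measurable_neq => //;
    exact: measurable_funD.
  by rewrite /B2; case: ifP => // _; exact: measurable_neq.
have nB w : kappa.-negligible (B w).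
  apply: negligibleU; last by exists (~` K); split => //; exact: measurableC.
  apply: negligibleU; last first.
    have [_ gi gE] := gP [::].
    apply: density_ae_unique => // A mA; rewrite -gE// integral_cst// mul1e.
    by rewrite rhoE cell_nil.
  have [_ gi gE] := gP w; apply: negligibleU.
    apply: density_ae_unique => //; first exact: measurable_funD.
    move=> A mA; rewrite -gE// rhoU//.
    have [_ i0 ->//] := gP (rcons w false); have [_ i1 ->//] := gP (rcons w
      true).
    by rewrite -integralD_EFin//; [exact: integrableS i0|exact: integrableS i1].
  rewrite /B2; case: ifPn => [/eqP L0|_]; last exact: negligible_set0.
  apply: density_ae_unique => // A mA; rewrite -gE// integral0.
  have : (rho w A <= (L w)%:E)%E.
    rewrite -leb_cell rhoE.
    by apply: le_measure; rewrite ?inE; [exact: mcellI|exact: mcell|exact: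
      subIsetl].
  by rewrite L0 => h; apply/eqP; rewrite eq_le h measure_ge0.
(* Words are countable, so one null set serves all of them. *)
pose Bo (o : option (seq bool)) := if o is Some w then B w else set0.
pose N := \bigcup_n Bo (unpickle n).
have mN : measurable N.
  apply: bigcupT_measurable => n; rewrite /Bo.
  by case: (unpickle n) => [w|]; [exact: mB|exact: measurable0].
have nN : kappa.-negligible N.
  apply: negligible_bigcup => n; rewrite /Bo.
  by case: (unpickle n) => [w|]; [exact: nB|exact: negligible_set0].
have BN w : B w `<=` N.
  by move=> y By; exists (pickle w) => //; rewrite /Bo pickleK.
pose F y w := \1_(~` N) y * g w y.
have F1 y w : ~ N y -> F y w = g w y by move=> Ny;
  rewrite /F indicE mem_set ?mul1r.
have F0 y w : N y -> F y w = 0 by move=> Ny; rewrite /F indicE memNset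
  ?mul0r//; exact.
exists F; split.
- move=> y; have [Ny|Ny] := pselect (N y).
    by split => [w|w]; rewrite !F0// addr0.
  split => [w|w]; first by rewrite F1//; have [] := gP w.
  rewrite !F1//; apply/eqP; apply: contrapT => /negP h; apply: Ny;
    apply: (BN w).
  by left; left; left.
- move=> w; apply: measurable_funM => //.
  by apply: measurable_indic; exact: measurableC.
- move=> w A mA; rewrite -rhoE; have [_ gi ->//] := gP w.
  apply: ae_eq_integral => //.
  + apply/measurable_EFinP; apply: measurable_funM.
      by apply: measurable_indic; exact: measurableC.
    exact: measurable_funTS.
  + exact/measurable_EFinP/measurable_funTS.
  + apply: negligibleS nN => y /= h; apply: contrapT => Ny; apply: h => _.
    by rewrite F1.
- move=> y w; have [Ny|Ny] := pselect (N y); first by rewrite F0// ltxx.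
  rewrite !F1// => gw.
  have BNy : ~ B w y by move=> /BN.
  split.
  + by apply: contrapT => Ky; apply: BNy; right.
  + apply: L_inhabited; rewrite lt_neqAle cL.1 andbT eq_sym; apply/negP => L0.
    by apply: BNy; left; left; right; rewrite /B2 L0/= gt_eqF.
  + apply/eqP; apply: contrapT => /negP h; apply: BNy; left; right; exact: h.
Qed.

(** The slow variable is [p.1] itself, not the slow part of the decoded conditional path. The
    comparison therefore uses cells given by two words, that of the slow point and that of the path;
    these cells have equal measures on both sides, and [H] is nearly constant on each. *)
Let limit_kernel : exists (G : set (X * U)) (s : X * U -> Iq -> R),
  [/\ measurable G,
      forall p, G p -> K p.1 /\ 0 <= p.2 < 1,
      (forall i, measurable_fun G (s ^~ i)) /\ (forall p, G p -> Q (s p)) &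
      forall H, unif_cts H -> Rintegral leb D0 (fun u => H (x1 u) (q1 u)) =
        Rintegral (kappa \x leb)%E G (fun p => H p.1 (s p))].
Proof.
have [F [cF mF iF Fpos]] := conditional_tree.
pose G := tdomain F.
have mG : measurable G by exact: measurable_tdomain.
have G_pos p k : G p -> 0 < F p.1 (tpath (F p.1) p.2 k).
  by move=> Gp; exact: tcell_pos.
have G_branch p : G p -> branch P (tpath (F p.1) p.2).
  move=> Gp; split; first exact: size_tpath.
    by move=> j k; exact: take_tpath.
  by move=> k; have [] := Fpos _ _ (G_pos p k Gp).
pose z2 (p : X * U) := decode P (tpath (F p.1) p.2).
pose s p := qpart (z2 p).
have GP p : G p -> P (z2 p) by move=> /G_branch; exact: P_decode.
have GK p : G p -> K p.1 by move=> Gp; have [] := Fpos _ _ (G_pos p 0 Gp).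
have G1 p : G p -> 0 <= p.2 < 1.
  by move=> Gp; have [_ _ F1] := Fpos _ _ (G_pos p 0 Gp); move: Gp;
    rewrite /G /tdomain/= F1.
have mcell2 w : measurable (G `&` [set p | tpath (F p.1) p.2 (size w) = w]).
  exact: measurable_tcell.
have ms i : measurable_fun G (s ^~ i).
  apply: (@measurable_decode _ (X * U)%type _ I P M G
    (fun p => tpath (F p.1) p.2) (inr i) PM) => //.
  by move=> p k; exact: size_tpath.
exists G, s; split => //.
  by move=> p Gp; split; [exact: GK|exact: G1].
  by split => // p /GP[].
move=> H HU.
have mH1 := measurable_H1 HU.
have myi (i : 'I_d) : measurable_fun G (fun p : X * U => p.1 ord0 i).
  apply: measurable_funTS; apply: (measurableT_comp (measurable_row_coord i)).
  exact: measurable_fst.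
have mH2 : measurable_fun G (fun p => H p.1 (s p)).
  by apply: measurable_integrand => // p /GP[].
pose coords (y : X) (i : 'I_d) : R := y ord0 i.
pose A k (t : k.-tuple bool) : set X := [set y | fword (coords y) k = t].
have mA k t : measurable (A k t).
  rewrite -[A k t]setTI; apply: measurable_fword => // i.
  exact: measurable_row_coord.
pose W1 k (u : U) := (word_tuple k (fword (coords (x1 u)) k),
  word_tuple k (tpath L u k)).
pose W2 k (p : X * U) := (word_tuple k (fword (coords p.1) k),
  word_tuple k (tpath (F p.1) p.2 k)).
have W1E k t : D0 `&` W1 k @^-1` [set t] = cell t.2 `&` x1 @^-1` (A k t.1).
  apply/seteqP; split => u /=.
    move=> [Du]; case: t => t1 t2 [/= h1 h2]; split.
      by split => //; rewrite /= size_tuple -h2 val_word_tuple ?size_tpath.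
    by rewrite /A/= -h1 val_word_tuple ?size_fword.
  move=> [[Du h2] h1]; split => //; rewrite /W1;
    case: t h1 h2 => t1 t2 /= h1 h2.
  rewrite size_tuple in h2.
  by congr pair; apply: val_inj; rewrite val_word_tuple ?size_tpath ?size_fword.
have W2E k t : G `&` W2 k @^-1` [set t] =
    (G `&` [set p | tpath (F p.1) p.2 (size t.2) = t.2]) `&` (A k t.1 `*` setT).
  apply/seteqP; split => p /=.
    move=> [Du]; case: t => t1 t2 [/= h1 h2]; split.
      by split => //; rewrite /= size_tuple -h2 val_word_tuple ?size_tpath.
    by split => //; rewrite /A/= -h1 val_word_tuple ?size_fword.
  move=> [[Du h2] [h1 _]]; split => //; rewrite /W2;
    case: t h1 h2 => t1 t2 /= h1 h2.
  rewrite size_tuple in h2.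
  by congr pair; apply: val_inj; rewrite val_word_tuple ?size_tpath ?size_fword.
have mW1 k t : measurable (D0 `&` W1 k @^-1` [set t]).
  by rewrite W1E; exact: mcellI.
have mW2 k t : measurable (G `&` W2 k @^-1` [set t]).
  by rewrite W2E; apply: measurableI; [exact: mcell2|exact: measurableX].
(* The section of the cell at [y] is an interval of length [F y t.2] when [y] lies in [A k t.1] and
   is empty otherwise; integrating over [y] gives the defining identity of the conditional tree. *)
have meas_eq k t : (kappa \x leb)%E (G `&` W2 k @^-1` [set t]) =
    leb (D0 `&` W1 k @^-1` [set t]).
  rewrite W1E -iF//= /product_measure1 [RHS]integral_mkcond.
  apply: eq_integral => y _ /=; rewrite patchE W2E.
  have secE : xsection (G `&` [set p | tpath (F p.1) p.2 (size t.2) = t.2] `&`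
      A k t.1 `*` setT) y = if y \in A k t.1 then
      `[0, F y [::][%classic `&` [set u | tpath (F y) u (size t.2) = t.2] else
        set0.
    apply/seteqP; split => u.
      rewrite /xsection/= inE => -[[/= Gp h2] [/= h1 _]].
      by rewrite mem_set//=; split => //; rewrite in_itv.
    case: ifPn => //; rewrite inE => h1 [/=]; rewrite in_itv/= => Gp h2.
    by rewrite /xsection/= inE; split.
  by rewrite secE; case: ifPn => _; rewrite ?measure0// tcell_measure.
have Gfin : ((kappa \x leb)%E G < +oo)%E by exact: product_unit_finite.
apply: (@eq_of_dist_le _ (fine (leb D0) + fine ((kappa \x leb)%E G))) => r r0.
have [e e0 he] := HU r r0.
have [k1 hk1] := @fword_close R 'I_d M e e0.
have [k2 hk2] := decode_close PM e0.
pose k := maxn k1 k2.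
(* Words of the slow point compare its [d] coordinates alone, so their representatives are taken in
   [K] rather than in [P]. *)
pose PK : set ('I_d -> R) := [set y | K (\row_i y i)].
pose ct (t : k.-tuple bool * k.-tuple bool) :=
  H (\row_i word_rep PK t.1 i) (qpart (word_rep P t.2)).
have near_rep (y : 'rV[R]_d) p t1 : K y -> t1 = fword (coords y) k -> branch P
  p ->
    `|H y (qpart (decode P p)) - H (\row_i word_rep PK t1 i) (qpart (word_rep P
      (p k)))| <= r.
  move=> Ky t1E bp.
  have Kc : PK (coords y).
    by rewrite /PK/= (_ : \row_i _ = y)//; apply/rowP => i; rewrite mxE.
  have iw : inhabited_word PK t1.
    by exists (coords y); rewrite t1E size_fword.
  have [Pr wr] := word_repP iw.
  apply: he => //.
  - by have [] := P_decode bp.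
  - by have [[]] := branch_rep k bp.
  - have PKM (y' : 'I_d -> R) : PK y' -> forall i, `|y' i| <= M.
      by move=> /KM h i; have := h i; rewrite mxE.
    move=> i; rewrite mxE; apply: hk1; [exact: PKM Kc|exact: PKM Pr|].
    rewrite t1E size_fword in wr.
    by rewrite t1E -(take_fword _ (leq_maxl k1 k2)) -[RHS](take_fword _
      (leq_maxl k1 k2)) -/k wr.
  - by move=> i; rewrite distrC; apply: hk2 => //; exact: leq_maxr.
have h1 : `|Rintegral leb D0 (fun u => H (x1 u) (q1 u)) -
    \sum_t ct t * fine (leb (D0 `&` W1 k @^-1` [set t]))| <= r * fine (leb D0).
  apply: measure_step => //; first by move=> t; exact: (mW1 k t).
  move=> u Du; rewrite /ct /W1 /= !val_word_tuple ?size_tpath ?size_fword//.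
  by apply: near_rep => //; [have [] := P1 Du|exact: branch_tpath].
have h2 : `|Rintegral (kappa \x leb)%E G (fun p => H p.1 (s p)) -
    \sum_t ct t * fine ((kappa \x leb)%E (G `&` W2 k @^-1` [set t]))|
    <= r * fine ((kappa \x leb)%E G).
  apply: measure_step => //; first by move=> t; exact: (mW2 k t).
  move=> p Gp; rewrite /ct /W2 /= !val_word_tuple ?size_tpath ?size_fword//.
  by apply: near_rep => //; [exact: GK|exact: G_branch].
move: h2; under eq_bigr do rewrite meas_eq; move=> h2.
rewrite mulrDr; apply: le_trans (lerD h1 h2).
set S1 := Rintegral _ _ _; set S2 := Rintegral _ _ _; set S3 := \sum_t _.
by rewrite (_ : S1 - S2 = (S1 - S3) - (S2 - S3)) ?ler_normB// opprB addrA subrK.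
Qed.

Lemma limit_measure : exists (k : {finite_measure set X -> \bar R})
    (G : set (X * U)) (s : X * U -> Iq -> R),
  [/\ k (~` K) = 0%E, (k setT <= (L [::])%:E)%E,
      [/\ measurable G, forall p, G p -> K p.1 /\ 0 <= p.2 < 1,
          forall i, measurable_fun G (s ^~ i) & forall p, G p -> Q (s p)] &
      forall H, unif_cts H ->
        measurable_fun G (fun p => H p.1 (s p)) /\
        \sum_(j : J (phi n)) a j * H (x j) (q j) @[n --> \oo] -->
        Rintegral (k \x leb)%E G (fun p => H p.1 (s p))].
Proof.
have [G [s [mG GP [ms sQ] GH]]] := limit_kernel.
exists kappa, G, s; split => // H HU; split; last first.
  by rewrite -GH//; exact: weighted_sums_cvg.
apply: measurable_integrand => //; last by move=> p /GP[].
move=> i; apply: measurable_funTS.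
by apply: (measurableT_comp (measurable_row_coord i)); exact: measurable_fst.
Qed.

End limit_space.

Theorem compactness_disintegration : exists (phi : nat -> nat)
    (kappa : {finite_measure set X -> \bar R}) (G : set (X * U))
    (s : X * U -> Iq -> R),
  [/\ {homo phi : m n / (m < n)%N}, kappa (~` K) = 0%E,
      (kappa setT <= l%:E)%E,
      [/\ measurable G, forall p, G p -> K p.1 /\ 0 <= p.2 < 1,
          forall i, measurable_fun G (s ^~ i) & forall p, G p -> Q (s p)] &
      forall H : 'rV[R]_d -> (Iq -> R) -> R, (forall r : R, 0 < r -> exists2 e
        : R, 0 < e & forall y y' t t',
          K y -> K y' -> Q t -> Q t' ->
          (forall i, `|y ord0 i - y' ord0 i| <= e) ->
          (forall i, `|t i - t' i| <= e) -> `|H y t - H y' t'| <= r) ->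
        measurable_fun G (fun p => H p.1 (s p)) /\
        \sum_(j : J (phi n)) a j * H (x j) (q j) @[n --> \oo] -->
        Rintegral (kappa \x leb)%E G (fun p => H p.1 (s p))].
Proof.
have [phi [L [hphi cL Ll Linh Lcv]]] := limit_tree.
have [kappa [G [s [kK kT GP GH]]]] := limit_measure cL Linh Lcv.
by exists phi, kappa, G, s; split => //; rewrite (le_trans kT)// lee_fin.
Qed.

End compactness_disintegration.

(** * Integrals, the torus and the test functions *)

Section raw_integral.
Context {disp : measure_display} {T : measurableType disp} {R : realType}.
Local Open Scope ereal_scope.
Import HBNNSimple.

(* [f] need not be measurable. *)
Lemma le_ge0_integral_raw (m : {measure set T -> \bar R}) (D : set T)
    (f g : T -> \bar R) :
  (forall t, D t -> 0 <= g t) -> (forall t, D t -> f t <= g t) ->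
  \int[m]_(t in D) f t <= \int[m]_(t in D) g t.
Proof.
move=> g0 fg; rewrite [leRHS]ge0_integralE// /integral.
rewrite -[leRHS]adde0; apply: leeD.
  apply: ereal_sup_le => _ [h /= hf <-].
  exists h => //= t; apply: le_trans (hf t) _; rewrite funeposE !patchE ge_max.
  by case: ifPn => [/set_mem Dt|_]; rewrite ?lexx// fg// g0.
rewrite oppe_le0; apply: ereal_sup_ubound; exists nnsfun0 => /=.
  by move=> t; rewrite funenegE le_max lexx orbT.
exact: sintegral0.
Qed.

(* [nu] is any set function, such as [vtotal_variation]. *)
Lemma ge0_le_set_integral (nu : set T -> \bar R) (tau : {measure set T -> \bar
  R})
    (f : T -> \bar R) :
  (forall A, measurable A -> 0 <= nu A <= tau A) -> (forall t, 0 <= f t) ->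
  \int[nu]_t f t <= \int[tau]_t f t.
Proof.
move=> nutau f0.
have nu0 : nu set0 = 0.
  have := nutau set0 measurable0; rewrite measure0 => /andP[h1 h2].
  by apply/eqP; rewrite eq_le h1 h2.
have snu (h : {nnsfun T >-> R}) : sintegral nu h =
    \sum_(r \in range h) r%:E * nu (h @^-1` [set r]).
  rewrite /sintegral (fsbig_widen (range h) setT)//= => r [_ Nhr] /=.
  by rewrite preimage10// nu0 mule0.
have h_ge0 (h : {nnsfun T >-> R}) r : range h r -> (0 <= r)%R.
  by move=> [t _ <-]; exact: fun_ge0.
have nuh (h : {nnsfun T >-> R}) r : 0 <= nu (h @^-1` [set r]) <= tau (h @^-1`
  [set r]).
  by apply: nutau; exact: measurable_sfunP.
rewrite ge0_integralTE// /integral patch_setT.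
have -> : f^\+ = f by apply/funext => t; rewrite funeposE; apply/max_idPl.
apply: (@le_trans _ _ (ereal_sup [set sintegral nu h | h in
    [set h : {nnsfun T >-> R} | forall t, (h t)%:E <= f t]])).
  (* The integral against a set function is a difference of two suprema; the subtracted one is
     nonnegative since the zero simple function takes part in it. *)
  rewrite -[leRHS]adde0; apply: leeD => //; rewrite oppe_le0.
  apply: ereal_sup_ubound; exists nnsfun0 => /=.
    by move=> t; rewrite funenegE le_max lexx orbT.
  by have := snu nnsfun0; rewrite fsbig1// => r [t _ <-]; rewrite mul0e.
apply: ge_ereal_sup => _ [h /= hf <-].
apply: (@le_trans _ _ (sintegral tau h)); last by apply: ereal_sup_ubound;
  exists h.
rewrite snu sintegralE; apply: lee_fsum => // r hr; apply: lee_wpmul2l.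
  by rewrite lee_fin (h_ge0 h).
by have /andP[] := nuh h r.
Qed.

End raw_integral.

Section section_integral.
Context {d1 d2 : measure_display} {X : measurableType d1} {U : measurableType
  d2}
  {R : realType}.
Variables (kappa : {finite_measure set X -> \bar R})
  (m : {sigma_finite_measure set U -> \bar R}) (G : set (X * U)) (f : X * U ->
    R)
  (B : R).
Hypotheses (mG : measurable G) (Gfin : ((kappa \x m)%E G < +oo)%E)
  (mf : measurable_fun G f) (fB : forall p, G p -> `|f p| <= B).

Let sec (y : X) : R := Rintegral m (xsection G y) (fun u => f (y, u)).

Let fi : (kappa \x m)%E.-integrable setT (EFin \o (f \_ G)).
Proof.
have : (kappa \x m)%E.-integrable G (EFin \o f) by exact: bounded_integrable fB.
by rewrite integrable_mkcond// restrict_EFin.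
Qed.

Let secE y : sec y = fine (fubini_F m (EFin \o (f \_ G)) y).
Proof.
rewrite /sec Rintegral_mkcond /Rintegral /fubini_F; congr fine.
apply: eq_integral => u _ /=; rewrite !patchE.
by rewrite mem_xsection.
Qed.

Lemma measurable_section_integral : measurable_fun [set: X] sec.
Proof.
rewrite (_ : sec = fine \o fubini_F m (EFin \o (f \_ G)));
  last exact/funext/secE.
apply: (measurableT_comp (@fine_measurable R _ measurableT)).
exact: measurable_fubini_F fi.
Qed.

Lemma Rintegral_section_integral :
  Rintegral kappa [set: X] sec = Rintegral (kappa \x m)%E G f.
Proof.
rewrite [RHS]Rintegral_mkcond /Rintegral -(integral12_prod_meas1 fi);
  congr fine.
apply: ae_eq_integral => //.
- apply/measurable_EFinP; exact: measurable_section_integral.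
- exact: measurable_fubini_F fi.
(* The integral over a section is known to be finite only for almost every [y]; there [fine] loses
   nothing. *)
have := integrable_ae measurableT (integrable_fubini_F fi).
apply: filterS => y h _; rewrite secE fineK//; exact: h.
Qed.

End section_integral.

Section torus_theory.
Context {R : realType} {d : nat}.

Lemma torus_pi_continuous : continuous (@torus_pi R d).
Proof. exact: pi_continuous. Qed.

Lemma measurable_torus_pi :
  measurable_fun [set: borel 'rV[R]_d] (@torus_pi R d : _ -> borel (torus R d)).
Proof.
move=> _; apply: (@measurability _ _ (borel 'rV[R]_d) (borel (torus R d)) setT
  (@torus_pi R d) (@open (torus R d))) => // _ [V oV <-].
rewrite setTI; apply: sub_sigma_algebra.
by move/continuousP : torus_pi_continuous; apply.
Qed.

Definition frac_row (y : 'rV[R]_d) : 'rV[R]_d :=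
  \row_i (y ord0 i - (Num.floor (y ord0 i))%:~R).

(** The upper bound is not strict because the cube has to be closed, both for compactness and for
    limits of features. *)
Lemma frac_row_itv y i : 0 <= frac_row y ord0 i <= 1.
Proof.
rewrite mxE; have := floor_le (y ord0 i); have := floorD1_gt (y ord0 i).
by rewrite intrD => h1 h2; apply/andP; split; lra.
Qed.

Lemma torus_pi_frac y : torus_pi (frac_row y) = torus_pi y.
Proof.
rewrite /torus_pi; apply/eqmodP; apply/forallP => i /=.
by rewrite mxE addrAC subrr add0r rpredN intr_int.
Qed.

Lemma torus_pi_surj (xi : torus R d) : exists2 y : 'rV[R]_d,
  (forall i, 0 <= y ord0 i <= 1) & xi = torus_pi y.
Proof.
exists (frac_row (repr xi)); first exact: frac_row_itv.
by rewrite torus_pi_frac /torus_pi reprK.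
Qed.

End torus_theory.

Lemma nbhs_coordP {R : realType} {d : nat} (V : set 'rV[R]_d) (y : 'rV[R]_d) :
  nbhs y V -> exists2 e : R, 0 < e &
    forall y' : 'rV[R]_d, (forall i, `|y' ord0 i - y ord0 i| < e) -> V y'.
Proof.
move=> /nbhs_interior; rewrite nbhsE => -[W [oW Wy] WV].
have [e e0 eW] := open_coordP oW Wy.
by exists e => // y' /eW/WV/interior_subset.
Qed.

Section two_scale_integrand.
Context {R : realType} {d : nat} (K : set 'rV[R]_d) (Psi : 'rV[R]_d * torus R d
  -> R).
Hypothesis cPsi : {within K `*` [set: torus R d], continuous Psi}.
Hypothesis compactK : compact K.

Lemma two_scale_local (y z : 'rV[R]_d) (r : R) : K y -> 0 < r ->
  exists2 e : R, 0 < e & forall y' z' : 'rV[R]_d, K y' ->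
    (forall i, `|y' ord0 i - y ord0 i| < e) ->
    (forall i, `|z' ord0 i - z ord0 i| < e) ->
    `|Psi (y', torus_pi z') - Psi (y, torus_pi z)| < r.
Proof.
move=> Ky r0; move/subspace_continuousP : cPsi => /(_ (y, torus_pi z)).
move=> /(_ (conj Ky Logic.I)) /cvgrPdist_lt /(_ r r0) [[V W] [/= nV nW] VW].
have [e1 e10 e1V] := nbhs_coordP nV.
have [e2 e20 e2W] := nbhs_coordP (torus_pi_continuous nW).
exists (Num.min e1 e2); first by rewrite lt_min e10.
move=> y' z' Ky' yy' zz'; rewrite distrC.
have h1 : V y' by apply: e1V => i; have := yy' i; rewrite lt_min => /andP[].
have h2 : W (torus_pi z') by apply: e2W => i; have := zz' i;
  rewrite lt_min => /andP[].
by apply: (VW (y', torus_pi z')).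
Qed.

Let cube : set 'rV[R]_d := [set z | forall i, 0 <= z ord0 i <= 1].

Let compact_cube : compact cube.
Proof.
have := @rV_compact R d (fun=> `[0, 1]%classic) (fun=> @segment_compact R 0 1).
by congr compact; apply/funext => z; apply/propext; split => h i; have := h i;
  rewrite /= in_itv.
Qed.

Let compact_KC : compact (K `*` cube).
Proof. exact: compact_setX. Qed.

Let nb (y : 'rV[R]_d) (e : R) : set 'rV[R]_d :=
  [set y' : 'rV[R]_d | forall i, `|y' ord0 i - y ord0 i| < e].

Let nbhs_coord (y : 'rV[R]_d) (e : R) : 0 < e -> nbhs y (nb y e).
Proof.
move=> e0; apply/nbhs_ballP; exists e => // y' [_ h] i.
by have := h ord0 i; rewrite /ball/= distrC.
Qed.

(** Uniformity is obtained on the compact set [K] times the cube: the torus carries only its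
    quotient topology, while closeness is measured in coordinates of representatives. *)
Lemma two_scale_unif (r : R) : 0 < r -> exists2 e : R, 0 < e &
  forall y y' z z', K y -> K y' -> cube z -> cube z' ->
    (forall i, `|y ord0 i - y' ord0 i| <= e) ->
    (forall i, `|z ord0 i - z' ord0 i| <= e) ->
    `|Psi (y, torus_pi z) - Psi (y', torus_pi z')| <= r.
Proof.
move=> r0; have r2 : 0 < r / 2 by rewrite divr_gt0.
pose near_pt (e : R) (p : 'rV[R]_d * 'rV[R]_d) := (K `*` cube) p ->
  forall y' z' : 'rV[R]_d, K y' -> (forall i, `|p.1 ord0 i - y' ord0 i| <= e) ->
    (forall i, `|p.2 ord0 i - z' ord0 i| <= e) ->
    `|Psi (p.1, torus_pi p.2) - Psi (y', torus_pi z')| <= r.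
have /compact_near_coveringP/(_ R (0^'+) near_pt _) := compact_KC.
have cov : forall p, (K `*` cube) p -> \forall p' \near p & e \near 0^'+,
  near_pt e p'.
  move=> [y z] [/= Ky cz]; have [e e0 he] := two_scale_local z Ky r2.
  (* Half of [e] locates the first point near the centre and half of it the second point near the
     first, so both values are within [r / 2] of the value at the centre. *)
  exists (nb y (e / 2) `*` nb z (e / 2), [set e' : R | e' < e / 2]) => /=.
    split; first by exists (nb y (e / 2), nb z (e / 2)) => //=;
      split; apply: nbhs_coord; rewrite divr_gt0.
    by apply: nbhs_right_lt; rewrite divr_gt0.
  move=> [[y0 z0] e'] /= [[h1 h2] e'e] [/= Ky0 cz0] y' z' Ky' h3 h4.
  have b1 : `|Psi (y0, torus_pi z0) - Psi (y, torus_pi z)| < r / 2.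
    by apply: he => // i; [have := h1 i|have := h2 i] => h; lra.
  have tri (a b c : R) : `|b - a| < e / 2 -> `|b - c| <= e' -> `|c - a| < e.
    move=> ab bc; rewrite (_ : c - a = (b - a) - (b - c)); last by lra.
    by apply: le_lt_trans (ler_normB _ _) _; lra.
  have b2 : `|Psi (y', torus_pi z') - Psi (y, torus_pi z)| < r / 2.
    by apply: he => // i; [apply: tri (h1 i) (h3 i)|apply: tri (h2 i) (h4 i)].
  move: b1 b2; set A0 := Psi (y0, _); set A1 := Psi (y', _);
    set A2 := Psi (y, _).
  move=> b1 b2; rewrite (_ : A0 - A1 = (A0 - A2) - (A1 - A2)); last by lra.
  by apply: le_trans (ler_normB _ _) _; lra.
move=> /(_ cov) h.
have [e [e0 he]] : exists e : R, 0 < e /\ K `*` cube `<=` near_pt e.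
  near (0 : R)^'+ => e; exists e; split; first by near: e; exact: nbhs_right_gt.
  by near: e.
exists e => // y y' z z' Ky Ky' cz cz' h1 h2.
by apply: (he (y, z)).
Unshelve. all: by end_near. Qed.

Lemma two_scale_bounded : exists2 B : R, 0 <= B &
  forall y xi, K y -> `|Psi (y, xi)| <= B.
Proof.
pose bnd (B : R) (p : 'rV[R]_d * 'rV[R]_d) := (K `*` cube) p ->
  `|Psi (p.1, torus_pi p.2)| <= B.
have /compact_near_coveringP/(_ R +oo%R bnd _) := compact_KC.
have cov : forall p, (K `*` cube) p -> \forall p' \near p & B \near +oo%R, bnd
  B p'.
  move=> [y z] [/= Ky cz]; have [e e0 he] := two_scale_local z Ky (@ltr01 R).
  exists (nb y e `*` nb z e, [set B : R | `|Psi (y, torus_pi z)| + 1 < B]) =>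
    /=.
    split; first by exists (nb y e, nb z e) => //=; split; exact: nbhs_coord.
    by apply: nbhs_pinfty_gt; exact: num_real.
  move=> [[y0 z0] B] /= [[h1 h2] hB] [/= Ky0 cz0].
  have := he y0 z0 Ky0 h1 h2; set A0 := Psi (y0, _); set A1 := Psi (y, _) => h.
  rewrite -(subrK A1 A0); apply: le_trans (ler_normD _ _) _.
  by rewrite /A1; move: hB; lra.
move=> /(_ cov) h.
have [B [B0 hB]] : exists B : R, 0 < B /\ K `*` cube `<=` bnd B.
  near (pinfty_nbhs R) => B; exists B; split; first by near: B;
    exact: nbhs_pinfty_gt.
  by near: B.
exists B; first exact: ltW.
move=> y xi Ky; have [z cz ->] := torus_pi_surj xi.
exact: (hB (y, z)).
Unshelve. all: by end_near. Qed.

Lemma measurable_two_scale_torus (y : 'rV[R]_d) : K y ->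
  measurable_fun [set: borel (torus R d)] (fun xi => Psi (y, xi)).
Proof.
move=> Ky _; apply: (measurability _ (RGenOInfty.measurableE R)) => //.
move=> _ [_ [a ->] <-]; rewrite setTI; apply: sub_sigma_algebra.
rewrite /open/= /quotient_open openE => z /=; rewrite in_itv/= andbT => az.
have az0 : 0 < Psi (y, torus_pi z) - a by rewrite subr_gt0.
have [e e0 he] := two_scale_local z Ky az0.
apply: filterS (nbhs_coord z e0) => z' /= hz.
have := he y z' Ky (fun i => _) hz; rewrite in_itv/= andbT.
move=> h; have {h} : `|Psi (y, torus_pi z') - Psi (y, torus_pi z)| <
    Psi (y, torus_pi z) - a by apply: h => i; rewrite subrr normr0.
rewrite /torus_pi ltr_norml => /andP[]; lra.
Qed.

Lemma measurable_two_scale (D : set 'rV[R]_d) (c : R) :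
  D `<=` K -> measurable_fun (D : set (borel 'rV[R]_d))
    (fun y => Psi (y, torus_pi (c *: y))).
Proof.
move=> DK; apply: (@coord_cts_measurable_fun _ (borel 'rV[R]_d) R 'I_d D
  (fun i (y : 'rV[R]_d) => y ord0 i)).
  by move=> i; apply: measurable_funTS; exact: measurable_row_coord.
move=> y r Dy r0; have [e e0 he] := two_scale_local (c *: y) (DK _ Dy) r0.
(* This radius keeps both the change of [y] and that of [c *: y] below [e]. *)
exists (e / (`|c| + 1)); first by rewrite divr_gt0// ltr_wpDl.
move=> y' Dy' yy'; apply: he; first exact: DK.
  move=> i; apply: lt_le_trans (yy' i) _.
  by rewrite ler_pdivrMr ?ltr_wpDl// mulrDr mulr1 lerDr mulr_ge0// ltW.
move=> i; rewrite !mxE -mulrBr normrM.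
have := yy' i; rewrite ltr_pdivlMr ?ltr_wpDl// => h.
apply: le_lt_trans h; rewrite mulrC ler_wpM2l//; lra.
Qed.

End two_scale_integrand.

(** * Bounds on the total variation of vector measures *)

Section total_variation.
Context {R : realType} {E : vectType R} (dot : {dot E for @idfun R}).
Context {disp : measure_display} {T : measurableType disp}.
Implicit Types mu : vmeasure dot T.

(** The total variation ranges over sequences, so the finite partition is enumerated and continued
    by empty sets. *)
Lemma vtotal_variation_partition mu (J : finType) (A : J -> set T) (D : set T) :
  (forall j, measurable (A j)) ->
  (forall j k, j != k -> A j `&` A k = set0) -> \bigcup_j A j = D ->
  (\sum_j (enorm dot (mu (A j)))%:E <= vtotal_variation mu D)%E.
Proof.
move=> mA tA AD.
pose Fo (o : option 'I_#|J|) := if o is Some i then A (enum_val i) else set0.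
pose F k := Fo (insub k).
have mF k : measurable (F k).
  by rewrite /F /Fo; case: (insub k) => [i|]; [exact: mA|exact: measurable0].
have FE (i : 'I_#|J|) : F i = A (enum_val i) by rewrite /F valK.
have tF : trivIset [set: nat] F.
  apply/trivIsetP => i k _ _ ik; rewrite /F.
  case: insubP => [i' _ i'E|_]; last by rewrite set0I.
  case: insubP => [k' _ k'E|_]; last by rewrite setI0.
  apply: tA; apply: contra ik => /eqP/enum_val_inj ik'.
  by rewrite -i'E -k'E ik'.
have UF : \bigcup_k F k = D.
  rewrite -AD; apply/seteqP; split => t [].
    move=> k _; rewrite /F; case: insubP => // i _ _ At.
    by exists (enum_val i).
  by move=> j _ At; exists (enum_rank j) => //; rewrite FE enum_rankK.
apply: (@le_trans _ _ (\sum_(k <oo) (enorm dot (mu (F k)))%:E)%E); last first.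
  by apply: ereal_sup_ubound; exists F.
apply: (@le_trans _ _ (\sum_(0 <= k < #|J|) (enorm dot (mu (F k)))%:E)%E);
  last first.
  by apply: nneseries_lim_ge => k _ _; rewrite lee_fin enorm_ge0.
rewrite big_mkord (reindex (@enum_val J J)); last first.
  by apply: onW_bij; exact: enum_val_bij.
by under [leRHS]eq_bigr do rewrite FE.
Qed.

Lemma enorm_le_vtotal_variation mu (D : set T) : measurable D ->
  ((enorm dot (mu D))%:E <= vtotal_variation mu D)%E.
Proof.
move=> mD; apply: le_trans (@vtotal_variation_partition mu unit (fun=> D) D _ _
  _) => //.
- by rewrite big_const cardT/= enumT unlock/= adde0.
- by apply/seteqP; split => t; [case|exists tt].
Qed.

Lemma vtotal_variation_ge0 mu (D : set T) : measurable D ->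
  (0 <= vtotal_variation mu D)%E.
Proof.
by move=> mD; apply: le_trans (enorm_le_vtotal_variation mu mD);
  rewrite lee_fin enorm_ge0.
Qed.

(** Provides the bound on disjoint pairs required by [charge_integral_step]; the rest of [D]
    completes the pair to a partition. *)
Lemma enormD_le_vtotal_variation mu (A B D : set T) :
  measurable A -> measurable B -> measurable D -> A `<=` D -> B `<=` D ->
  A `&` B = set0 ->
  ((enorm dot (mu A) + enorm dot (mu B))%:E <= vtotal_variation mu D)%E.
Proof.
move=> mA mB mD AD BD AB.
pose F (o : option bool) := match o with
  Some true => A | Some false => B | None => D `\` (A `|` B) end.
apply: le_trans (@vtotal_variation_partition mu _ F D _ _ _).
- rewrite (bigD1 (Some true))//= (bigD1 (Some false))//= addeA -EFinD.
  by rewrite leeDl// sume_ge0// => o _; rewrite lee_fin enorm_ge0.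
- by case=> [[]|] //; apply: measurableD => //; exact: measurableU.
- have BA : B `&` A = set0 by rewrite setIC.
  have h1 : A `&` (D `\` (A `|` B)) = set0.
    by apply/seteqP; split => // t [At [_ /not_orP[]]].
  have h2 : B `&` (D `\` (A `|` B)) = set0.
    by apply/seteqP; split => // t [Bt [_ /not_orP[]]].
  by case=> [[]|] [[]|] //= _; rewrite setIC.
- apply/seteqP; split => t.
    by move=> [[[]|] _ /=]; [exact: AD|exact: BD|case].
  move=> Dt; have [At|At] := pselect (A t); first by exists (Some true).
  have [Bt|Bt] := pselect (B t); first by exists (Some false).
  by exists None => //; split => // -[].
Qed.

Lemma vtotal_variation_le mu (tau : {finite_measure set T -> \bar R}) (D : set
  T) :
  (forall A, measurable A -> enorm dot (mu A) <= fine (tau A)) ->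
  (vtotal_variation mu D <= tau D)%E.
Proof.
move=> mutau; apply: ge_ereal_sup => _ [F [mF tF UF] <-].
apply: (@le_trans _ _ (\sum_(k <oo) tau (F k))%E).
  apply: lee_nneseries => k _; first by rewrite lee_fin enorm_ge0.
  by rewrite -[leRHS]fineK ?fin_num_measure// lee_fin mutau.
rewrite -UF measure_bigcup//; rewrite le_eqVlt; apply/orP; left; apply/eqP.
apply: eq_eseriesl => k.
by rewrite in_setT.
Qed.

End total_variation.

(** * Features with a direction of norm at most one *)

Section euclidean_coordinates.
Context {R : realType} {E : vectType R} (dot : {dot E for @idfun R}) (I :
  finType).
Local Notation b := (vbasis {:E}).
Implicit Types s : I + 'I_(\dim {:E}) -> R.

Definition coord_vec s : E := \sum_(i < \dim {:E}) s (inr i) *: b`_i.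

Lemma coord_coord_vec s i : coord b i (coord_vec s) = s (inr i).
Proof. by rewrite coord_sum_free//; exact: basis_free (vbasisP _). Qed.

Lemma dot_coord_vec s (v : E) :
  dot (coord_vec s) v = \sum_(i < \dim {:E}) s (inr i) * dot b`_i v.
Proof.
rewrite dotC linear_sumr; apply: eq_bigr => i _.
by rewrite linearZr_LR/= dotC.
Qed.

(* The second condition says [enorm dot (coord_vec s) <= 1], in a form that is
   linear in [s]. *)
Definition unit_features : set (I + 'I_(\dim {:E}) -> R) :=
  [set s | (forall i, 0 <= s (inl i) <= 1) /\
           (forall v, dot (coord_vec s) v <= enorm dot v)].

Lemma unit_features_bounded : exists2 M : R, 0 <= M &
  forall s, unit_features s -> forall i, `|s i| <= M.
Proof.
have /choice[c cP] : forall i : 'I_(\dim {:E}), exists c : R,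
    0 <= c /\ forall v, `|coord b i v| <= c * enorm dot v.
  by move=> i; have [c c0 h] := coord_le dot i; exists c.
have c0 i : 0 <= c i by have [] := cP i.
exists (1 + \sum_i c i); first by rewrite addr_ge0// sumr_ge0.
move=> s [s01 sv] [i|i].
  have /andP[h1 h2] := s01 i; rewrite ger0_norm//.
  by rewrite (le_trans h2)// lerDl sumr_ge0.
(* The linear condition tested at [coord_vec s] itself says that the square of the norm is at most
   the norm. *)
have n1 : enorm dot (coord_vec s) <= 1.
  have := sv (coord_vec s); rewrite -enorm_sqr expr2.
  have [h _|h] := leP (enorm dot (coord_vec s)) 0;
    first exact: le_trans h ler01.
  by rewrite ger_pMl.
rewrite -coord_coord_vec; have [_ h] := cP i; apply: le_trans (h _) _.
apply: (@le_trans _ _ (c i)); first by rewrite ler_piMr.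
by rewrite (bigD1 i)//= addrCA lerDl addr_ge0// sumr_ge0.
Qed.

Lemma unit_features_closed s : (forall e : R, 0 < e ->
  exists2 s', unit_features s' & forall i, `|s' i - s i| <= e) -> unit_features
    s.
Proof.
move=> h; split => [i|v].
  apply/andP; split; apply/ler_addgt0Pr => e e0;
    have [s' [s01 _] ss'] := h e e0; have /andP[h1 h2] := s01 i;
    by have := ss' (inl i); rewrite ler_norml => /andP[]; lra.
apply/ler_addgt0Pr => e e0.
(* [D] exceeds the Lipschitz constant of the linear form paired with [v], so an [e / D] change of
   the features moves the pairing by at most [e]. *)
pose D := 1 + \sum_(i < \dim {:E}) `|dot b`_i v|.
have D0 : 0 < D by rewrite ltr_wpDr// sumr_ge0.
have [s' [_ sv] ss'] := h (e / D) (divr_gt0 e0 D0).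
rewrite -(subrK (dot (coord_vec s') v) (dot (coord_vec s) v)) addrC.
apply: lerD; first exact: sv.
rewrite !dot_coord_vec -sumrB; apply: le_trans (ler_norm _) _.
apply: le_trans (ler_norm_sum _ _ _) _.
apply: (@le_trans _ _ (e / D * \sum_(i < \dim {:E}) `|dot b`_i v|)).
  rewrite mulr_sumr; apply: ler_sum => i _; rewrite -mulrBl normrM.
  by rewrite ler_wpM2r// distrC.
rewrite mulrAC ler_pdivrMr// ler_wpM2l ?(ltW e0)// /D lerDr//.
Qed.

End euclidean_coordinates.

Lemma measurable_frac_row {R : realType} {d : nat} (c : R) (i : 'I_d) :
  measurable_fun [set: borel 'rV[R]_d] (fun y => frac_row (c *: y) ord0 i).
Proof.
under eq_fun do rewrite !mxE.
have mc : measurable_fun [set: borel 'rV[R]_d] (fun y => c * y ord0 i).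
  by apply: measurable_funM => //; exact: measurable_row_coord.
apply: measurable_funB => //.
have mfl : measurable_fun [set: R] (fun t : R => (Num.floor t)%:~R : R).
  apply: nondecreasing_measurable => // s t st.
  by rewrite ler_int; exact: le_floor.
exact: (measurableT_comp mfl mc).
Qed.

(** * The vector measures on the torus *)

Section kernel_measure.
Context {R : realType} {d : nat} {E : vectType R} (dot : {dot E for @idfun R}).
Local Notation X := (borel 'rV[R]_d).
Local Notation U := (measurableTypeR R).
Local Notation leb := (@lebesgue_measure R).
Local Notation b := (vbasis {:E}).
Local Notation dE := (\dim {:E}).
Variables (G : set (X * U)) (s : X * U -> 'I_d + 'I_dE -> R).
Hypothesis mG : measurable G.
Hypothesis G01 : forall p, G p -> 0 <= p.2 < 1.
Hypothesis ms : forall i, measurable_fun G (s ^~ i).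
Hypothesis sQ : forall p, G p -> unit_features dot (s p).

Definition fast_point (p : X * U) : borel (torus R d) :=
  torus_pi (\row_k s p (inl k)).

Lemma measurable_fast_point : measurable_fun G fast_point.
Proof.
apply: (measurableT_comp measurable_torus_pi).
apply: (@coord_open_measurable_fun _ (X * U)%type R 'rV[R]_d 'I_d G
  (fun k p => s p (inl k))) => [k|V p oV Gp Vp]; first exact: ms.
have [e e0 eV] := open_coordP oV Vp; exists e => // p' _ h.
by apply: eV => k; rewrite !mxE.
Qed.

Let Gx (y : X) : set U := xsection G y.

Let GxE y u : Gx y u -> G (y, u).
Proof. by rewrite /Gx /xsection/= inE. Qed.

Let mGx y : measurable (Gx y). Proof. exact: measurable_xsection. Qed.

Let Gx_le1 y : (leb (Gx y) <= 1)%E.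
Proof.
have -> : 1%E = leb `[0%R, 1%R[%classic.
  by rewrite lebesgue_measure_itv/= lte_fin ltr01 oppr0 adde0.
apply: le_measure; rewrite ?inE; [exact: mGx|exact: measurable_itv|].
by move=> u /GxE/G01 /=; rewrite in_itv.
Qed.

Let Gx_fin y : (leb (Gx y) < +oo)%E.
Proof. by apply: le_lt_trans (Gx_le1 y) _; rewrite ltry. Qed.

Let measurable_section {disp : measure_display} {T : measurableType disp}
  (f : X * U -> T) y : measurable_fun G f -> measurable_fun (Gx y) (fun u => f
    (y, u)).
Proof.
move=> mf; apply: (@measurable_comp _ _ _ U (X * U)%type T G f (Gx y) (pair y))
  => //.
  by move=> _ [u Gu <-]; exact: GxE.
by apply: measurable_funTS; exact: pair1_measurable.
Qed.

Let msec y i : measurable_fun (Gx y) (fun u => s (y, u) i).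
Proof. exact: (@measurable_section _ _ (fun p => s p i) y (@ms i)). Qed.

Let phi y (u : U) := fast_point (y, u).

Let mphi y : measurable_fun (Gx y) (phi y).
Proof. by apply: measurable_section; exact: measurable_fast_point. Qed.

(** Lebesgue measure on the section of [G] at [y], weighted by the [i]-th coordinate of the
    direction and pushed to the torus by the fast variable. *)
Definition kernel_coord (y : X) (i : 'I_dE) (B : set (borel (torus R d))) : R :=
  Rintegral leb (xsection G y `&` (fun u => fast_point (y, u)) @^-1` B)
    (fun u => s (y, u) (inr i)).

Let tau y : {finite_measure set (borel (torus R d)) -> \bar R} :=
  domain_finite_law (mGx y) (Gx_fin y) (@mphi y).

Let theta y B : E := \sum_i kernel_coord y i B *: b`_i.

Let mS y B : measurable B -> measurable (Gx y `&` phi y @^-1` B).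
Proof. by move=> mB; exact: mphi. Qed.

Let msS y i B : measurable B ->
  measurable_fun (Gx y `&` phi y @^-1` B) (fun u => s (y, u) (inr i)).
Proof.
move=> mB; apply: (measurable_funS (mGx y) _ (@msec y (inr i))).
exact: subIsetl.
Qed.

Let S_fin y B : measurable B -> (leb (Gx y `&` phi y @^-1` B) < +oo)%E.
Proof.
move=> mB; apply: le_lt_trans (Gx_fin y).
by apply: le_measure; rewrite ?inE; [exact: mS|exact: mGx|exact: subIsetl].
Qed.

Let s_integrable y i B : measurable B -> leb.-integrable (Gx y `&` phi y @^-1`
  B)
  (EFin \o (fun u => s (y, u) (inr i))).
Proof.
move=> mB; have [M _ QM] := unit_features_bounded dot 'I_d.
apply: (@bounded_integrable _ _ _ _ _ _ M); [exact: mS|exact: S_fin|exact: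
  msS|].
by move=> u [/GxE/sQ/QM h _]; exact: h.
Qed.

(** Pairing with a fixed vector reduces the bound on a vector integral to a scalar one, where
    [unit_features] applies pointwise. Taking the vector to be [theta y B] then bounds its norm. *)
Let dot_theta y B v : measurable B ->
  dot (theta y B) v <= enorm dot v * fine (leb (Gx y `&` phi y @^-1` B)).
Proof.
move=> mB.
have -> : dot (theta y B) v = Rintegral leb (Gx y `&` phi y @^-1` B)
    (fun u => dot (coord_vec (s (y, u))) v).
  transitivity (\sum_i kernel_coord y i B * dot b`_i v).
    rewrite dotC linear_sumr; apply: eq_bigr => i _.
    by rewrite linearZr_LR/= dotC.
  under [RHS]eq_Rintegral do rewrite dot_coord_vec.
  rewrite Rintegral_sum; [|exact: mS|].
    apply: eq_bigr => i _; rewrite RintegralZr//;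
      [exact: mS|exact: s_integrable].
  move=> i.
  have := integrableZr (mS y mB) (dot b`_i v) (s_integrable y i mB).
  by apply: eq_integrable => //; exact: mS.
rewrite -Rintegral_cst; last exact: mS.
apply: le_Rintegral; first exact: mS.
- have mdot : measurable_fun (Gx y `&` phi y @^-1` B)
      (fun u => dot (coord_vec (s (y, u))) v).
    under eq_fun do rewrite dot_coord_vec.
    by apply: measurable_sum => i; apply: measurable_funM => //; exact: msS.
  apply: (@bounded_integrable _ _ _ _ _ _ (enorm dot v));
    [exact: mS|exact: S_fin|exact: mdot|].
  move=> u [/GxE/sQ[_ h] _]; rewrite ler_norml h andbT lerNl -linearNr/=.
  by rewrite -(enormN dot v).
- apply: (@bounded_integrable _ _ _ _ _ _ (enorm dot v));
    [exact: mS|exact: S_fin|exact: measurable_cst|].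
  by move=> u _; rewrite ger0_norm// enorm_ge0.
- by move=> u [/GxE/sQ[_ h] _]; exact: h.
Qed.

Let enorm_theta y B : measurable B -> enorm dot (theta y B) <= fine (tau y B).
Proof.
move=> mB; have := dot_theta y (theta y B) mB; rewrite -enorm_sqr expr2.
have [h _|h] := leP (enorm dot (theta y B)) 0; last by rewrite ler_pM2l.
by apply: le_trans h _; rewrite fine_ge0.
Qed.

(** The second clause has the form in which [gprod] uses the total variation, namely as a set
    function to integrate against. It is dominated by [tau y], whose mass is the length of a section
    of [G], contained in the unit interval. *)
Lemma kernel_measure_exists : exists theta : X -> vmeasure dot (borel (torus R
  d)),
  (forall y B, theta y B = \sum_i kernel_coord y i B *: b`_i) /\
  (forall y, (\int[vtotal_variation (theta y)]_xi 1 <= 1)%E).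
Proof.
suff h y : exists v : vmeasure dot (borel (torus R d)),
    (forall B, v B = theta y B) /\ (\int[vtotal_variation v]_xi 1 <= 1)%E.
  have [v hv] := choice h; exists v; split => y; first by have [] := hv y.
  by have [_] := hv y.
have [v vE] : exists v : vmeasure dot (borel (torus R d)), forall B, v B =
  theta y B.
  apply: (vmeasure_dominated (tau := tau y)); last by move=> B;
    exact: enorm_theta.
  move=> A B mA mB AB; rewrite /theta -big_split/=; apply: eq_bigr => i _.
  rewrite -scalerDl; congr (_ *: _); rewrite /kernel_coord preimage_setU setIUr.
  rewrite Rintegral_setU//; [exact: mS|exact: mS| |].
    rewrite -setIUr -preimage_setU; apply: s_integrable; exact: measurableU.
  apply/disj_set2P/seteqP; split => // u [[_ /= h1] [_ /= h2]].
  by rewrite -[False]/(set0 (fast_point (y, u))) -AB; split.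
exists v; split => //.
apply: (@le_trans _ _ (\int[tau y]_xi 1)%E).
  apply: ge0_le_set_integral => // B mB; rewrite vtotal_variation_ge0//=.
  have h A : measurable A -> enorm dot (v A) <= fine (tau y A).
    by move=> mA; rewrite vE; exact: enorm_theta.
  exact: (vtotal_variation_le B h).
rewrite integral_cst//= mul1e /domain_law preimage_setT setIT; exact: Gx_le1.
Qed.

Lemma charge_integral_kernel (v : vmeasure dot (borel (torus R d))) (y : X) i
    (f : torus R d -> R) (C : R) :
  (forall B, v B = \sum_i kernel_coord y i B *: b`_i) ->
  measurable_fun [set: borel (torus R d)] f -> (forall xi, `|f xi| <= C) ->
  charge_integral (vcoord v i) [set: borel (torus R d)] f =
  Rintegral leb (xsection G y) (fun u => f (fast_point (y, u)) * s (y, u) (inr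
    i)).
Proof.
move=> vE mf fC; have [M M0 QM] := unit_features_bounded dot 'I_d.
apply: (@charge_integral_density _ _ _ _ _ leb (Gx y) (phi y)
  (fun u => s (y, u) (inr i)) _ f M C).
- exact: mGx.
- exact: Gx_fin.
- exact: mphi.
- exact: msec.
- exact: M0.
- by move=> u /GxE/sQ/QM h; exact: h.
- move=> B mB; transitivity (coord b i (v B))%:E; first by [].
  rewrite vE coord_sum_free//.
  exact: basis_free (vbasisP _).
- exact: mf.
- exact: fC.
Qed.

Lemma measurable_kernel_coord (kappa : {finite_measure set X -> \bar R}) i B :
  measurable B -> measurable_fun [set: X] (fun y => kernel_coord y i B).
Proof.
move=> mB; have [M M0 QM] := unit_features_bounded dot 'I_d.
(* Moving the condition on the fast variable into the domain turns [kernel_coord] into an integral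
   over sections, measurable by Fubini. *)
pose GB := G `&` fast_point @^-1` B.
have mGB : measurable GB by exact: measurable_fast_point.
have -> : (fun y => kernel_coord y i B) =
    (fun y => Rintegral leb (xsection GB y) (fun u => s (y, u) (inr i))).
  apply/funext => y; congr (Rintegral _ _ _).
  by apply/seteqP; split => u; rewrite /xsection/= !inE.
apply: (@measurable_section_integral _ _ X U R kappa leb GB (fun p => s p (inr
  i)) M) => //.
- by apply: product_unit_finite => // p [/G01].
- by apply: (measurable_funS mG _ (@ms (inr i))); exact: subIsetl.
- by move=> p [/sQ/QM h _]; exact: h.
Qed.

End kernel_measure.

(** * Discretisation of the measures and conclusion *)

Section two_scale_compactness.
Context {R : realType} {d : nat} (Omega : set 'rV[R]_d) {E : vectType R}
  (dot : {dot E for @idfun R}) (eps : nat -> R)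
  (mu : nat -> vmeasure dot (borel 'rV[R]_d)) (C : R).
Hypothesis openO : open Omega.
Hypothesis boundedO : bounded_set Omega.
Hypothesis mu_le : forall n, (vtotal_variation (mu n) Omega <= C%:E)%E.

Local Notation X := (borel 'rV[R]_d).
Local Notation b := (vbasis {:E}).
Local Notation K := (closure Omega).
Local Notation dE := (\dim {:E}).
Local Notation Iq := ('I_d + 'I_dE)%type.

Let closedK : closed K. Proof. exact: closed_closure. Qed.

Let mOmega : measurable (Omega : set X). Proof. exact: sub_sigma_algebra. Qed.

Let K_bounded : exists2 M : R, 1 <= M & forall y, K y -> forall i, `|y ord0 i|
  <= M.
Proof.
have [M [_ hM]] := boundedO.
have OM y : Omega y -> forall i, `|y ord0 i| <= `|M| + 1.
  move=> Oy i; have /= := hM (`|M| + 1) _ y Oy.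
  rewrite ltr_pwDr ?ler_norm// => /(_ isT); apply: le_trans.
  rewrite [leRHS]/Num.norm/= mx_normrE.
  exact: (le_bigmax _ (fun ij : 'I_1 * 'I_d => `|y ij.1 ij.2|) (ord0, i)).
exists (`|M| + 2) => [|y Ky i]; first by have := normr_ge0 M; lra.
have ny : nbhs y [set y' : 'rV[R]_d | `|y' ord0 i - y ord0 i| < 1].
  apply/nbhs_ballP; exists 1 => //= y' [_ h].
  by have := h ord0 i; rewrite /ball/= distrC.
have [y' [/OM/(_ i) h1 /= h2]] := Ky _ ny.
rewrite -(subKr (y' ord0 i) (y ord0 i)); apply: le_trans (ler_normB _ _) _; lra.
Qed.

Let compactK : compact K.
Proof.
have [M _ KM] := K_bounded.
apply: (@subclosed_compact _ _ [set y : 'rV[R]_d | forall i, `[- M, M]%classic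
  (y ord0 i)]) => //.
  by apply: (@rV_compact R d (fun=> `[- M, M]%classic)) => i;
    exact: segment_compact.
by move=> y /KM h i; rewrite /= in_itv/= -ler_norml.
Qed.

Let feat n (y : 'rV[R]_d) (i : 'I_d + 'I_d) : R :=
  match i with
  | inl i => y ord0 i
  | inr i => frac_row ((eps n)^-1 *: y) ord0 i
  end.

(** The word length equals the index [n]: each partition is finite, and the partitions eventually
    resolve the features to any prescribed precision. *)
Let A n (j : n.-tuple bool) : set X :=
  Omega `&` [set y | fword (feat n y) n = j].

Let mA n (j : n.-tuple bool) : measurable (A j).
Proof.
apply: measurable_fword => // -[i|i] /=; apply: measurable_funTS.
  exact: measurable_row_coord.
exact: measurable_frac_row.
Qed.

Let A_preimage n (j : n.-tuple bool) :
  Omega `&` (fun y => word_tuple n (fword (feat n y) n)) @^-1` [set j] = A j.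
Proof.
by congr (_ `&` _); apply/funext => y /=; rewrite word_tuple_eq ?size_fword.
Qed.

(** The default [0], possibly outside [Omega], is taken only on empty cells, which have weight
    zero. *)
Let pt n (j : n.-tuple bool) : 'rV[R]_d :=
  if pselect (exists y, A j y) is left h then projT1 (cid h) else 0.

Let ptP n (j : n.-tuple bool) y : A j y -> A j (pt j).
Proof.
by move=> Ay; rewrite /pt; case: pselect => [h|[]]; [case: cid|exists y].
Qed.

Let wt n (j : n.-tuple bool) : R := enorm dot (mu n (A j)).

(** When [wt j] vanishes, so does [mu n (A j)], and the zero result of the division keeps
    [wt_feature] true. *)
Let feature n (j : n.-tuple bool) (i : Iq) : R :=
  match i with
  | inl i => frac_row ((eps n)^-1 *: pt j) ord0 i
  | inr i => coord b i (mu n (A j)) / wt j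
  end.

Let wt_feature n (j : n.-tuple bool) i :
  wt j * feature j (inr i) = coord b i (mu n (A j)).
Proof.
have [w0|w0] := eqVneq (wt j) 0; last by rewrite /= mulrC divfK.
by rewrite w0 mul0r (enorm_eq0 w0) linear0.
Qed.

Let wt_gt0 n (j : n.-tuple bool) : 0 < wt j ->
  Omega (pt j) /\ unit_features dot (feature j).
Proof.
move=> w0; split.
  have [y Ay] : exists y, A j y.
    apply: contrapT => h; move: w0; rewrite /wt (_ : A j = set0).
      by rewrite vmeasure0 enorm0 ltxx.
    by apply/seteqP; split => // y Ay; apply: h; exists y.
  by have [] := ptP Ay.
split => [i|v]; first exact: frac_row_itv.
have -> : coord_vec (feature j) = (wt j)^-1 *: mu n (A j).
  rewrite [in RHS](coord_vbasis (memvf (mu n (A j)))) scaler_sumr.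
  by apply: eq_bigr => i _; rewrite scalerA mulrC.
rewrite linearZl_LR/= ler_pdivrMl//.
exact: le_trans (ler_norm _) (dot_le_enorm _ _ _).
Qed.

Let disjA n (j k : n.-tuple bool) : j != k -> A j `&` A k = set0.
Proof.
move=> jk; apply/seteqP; split => // y [[_ /= h1] [_ /= h2]].
by move: jk; rewrite -val_eqE/= -h1 -h2 eqxx.
Qed.

Let unionA n : \bigcup_(j in [set: n.-tuple bool]) A j = Omega.
Proof.
apply/seteqP; split => y; first by case=> j _ [].
move=> Oy; exists (word_tuple n (fword (feat n y) n)) => //; split => //=.
by rewrite val_word_tuple// size_fword.
Qed.

Let tv n : R := fine (vtotal_variation (mu n) Omega).

Let tv_ge0 n : (0 <= vtotal_variation (mu n) Omega)%E.
Proof. exact: vtotal_variation_ge0. Qed.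

Let tvE n : vtotal_variation (mu n) Omega = (tv n)%:E.
Proof.
by rewrite /tv fineK// ge0_fin_numE// (le_lt_trans (mu_le n))// ltry.
Qed.

Let wt_le n : \sum_(j : n.-tuple bool) wt j <= tv n.
Proof.
rewrite -lee_fin -tvE -sumEFin; apply: vtotal_variation_partition => //.
- by move=> j k; exact: disjA.
- exact: unionA.
Qed.

Let tv_le n : tv n <= C.
Proof. by rewrite -lee_fin -tvE. Qed.

Let integrand (Psi : 'rV[R]_d * torus R d -> R) (i : 'I_dE)
    (y : 'rV[R]_d) (s : Iq -> R) : R :=
  Psi (y, torus_pi (\row_k s (inl k))) * s (inr i).

Let integrand_unif Psi i : {within K `*` [set: torus R d], continuous Psi} ->
  forall r : R, 0 < r -> exists2 e : R, 0 < e & forall y y' s s',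
    K y -> K y' -> unit_features dot s -> unit_features dot s' ->
    (forall i, `|y ord0 i - y' ord0 i| <= e) ->
    (forall i, `|s i - s' i| <= e) ->
    `|integrand Psi i y s - integrand Psi i y' s'| <= r.
Proof.
move=> cPsi r r0.
have [B B0 PsiB] := two_scale_bounded cPsi compactK.
have [M M0 QM] := unit_features_bounded dot 'I_d.
have D0 : 0 < 2 * (M + B + 1) by lra.
(* [M] bounds the features and [B] bounds [Psi]; each of the two terms of the product estimate below
   receives half of [r]. *)
pose r' := r / (2 * (M + B + 1)).
have r'0 : 0 < r' by exact: divr_gt0.
have [e e0 he] := two_scale_unif cPsi compactK r'0.
exists (Num.min e r'); first by rewrite lt_min e0.
move=> y y' s s' Ky Ky' Qs Qs' yy' ss'.
have h1 : `|Psi (y, torus_pi (\row_k s (inl k))) -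
    Psi (y', torus_pi (\row_k s' (inl k)))| <= r'.
  apply: he => // [k|k|k|k]; rewrite ?mxE; try by have [h _] := Qs; exact: h.
  - by have [h _] := Qs'; exact: h.
  - by have := yy' k; rewrite le_min => /andP[].
  - by have := ss' (inl k); rewrite le_min => /andP[].
have h2 : `|s (inr i) - s' (inr i)| <= r'.
  by have := ss' (inr i); rewrite le_min => /andP[].
rewrite /integrand.
have h3 := QM s Qs (inr i); have h4 := PsiB y' (torus_pi (\row_k s' (inl k)))
  Ky'.
move: h1 h2 h3 h4.
move: (Psi (y, _)) (Psi (y', _)) (s (inr i)) (s' (inr i)) => p p' t t' h1 h2 h3
  h4.
rewrite (_ : p * t - p' * t' = (p - p') * t + p' * (t - t')); last by lra.
apply: le_trans (ler_normD _ _) _; rewrite !normrM.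
have -> : r = r' * (M + B + 1) + r' * (M + B + 1).
  by rewrite -mulrDr -[_ + (M + B + 1)]mulr2n -mulr_natl divfK// gt_eqF.
apply: lerD; first by apply: ler_pM => //; lra.
by rewrite mulrC; apply: ler_pM => //; lra.
Qed.

(** The depth [N] does not depend on [eps n], however fast the test function oscillates: the fast
    variable is itself among the compared features, so the integrand is nearly constant on every
    cell. *)
Lemma discretization Psi i : {within K `*` [set: torus R d], continuous Psi} ->
  charge_integral (vcoord (mu n) i) Omega
    (fun y => Psi (y, torus_pi ((eps n)^-1 *: y))) -
  \sum_(j : n.-tuple bool) wt j * integrand Psi i (pt j) (feature j)
  @[n --> \oo] --> (0 : R).
Proof.
move=> cPsi; have [ci ci0 hci] := coord_le dot i.
have C0 : 0 <= C by apply: le_trans (tv_le 0); apply: le_trans (wt_le 0);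
  apply: sumr_ge0 => j _; exact: enorm_ge0.
apply/cvgr0Pnorm_le => r r0.
(* The [i]-th coordinate is bounded by [ci] times the norm, so [ci * C] bounds the variation of the
   coordinate charge. *)
pose r' := r / (ci * C + 1).
have D0 : 0 < ci * C + 1 by rewrite ltr_wpDl// mulr_ge0.
have r'0 : 0 < r' by exact: divr_gt0.
have [e e0 he] := two_scale_unif cPsi compactK r'0.
have [M M1 KM] := K_bounded.
have [N hN] := @fword_close R ('I_d + 'I_d)%type M e e0.
have featM n y : K y -> forall k, `|feat n y k| <= M.
  move=> Ky [k|k] /=; first exact: KM.
  have /andP[h1 h2] := frac_row_itv ((eps n)^-1 *: y) k.
  by rewrite ger0_norm// (le_trans h2).
exists N => // n /= Nn.
pose f y := Psi (y, torus_pi ((eps n)^-1 *: y)).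
(* Weight times direction restores the value of the coordinate charge on the cell, so the weighted
   sum is exactly its step sum. *)
have -> : \sum_(j : n.-tuple bool) wt j * integrand Psi i (pt j) (feature j) =
    \sum_(j : n.-tuple bool) f (pt j) *
      fine (vcoord (mu n) i (Omega `&` (fun y => word_tuple n (fword (feat n y)
        n)) @^-1` [set j])).
  apply: eq_bigr => j _; rewrite A_preimage /integrand mulrCA wt_feature /=.
  congr (_ * _); rewrite /f -(torus_pi_frac ((eps n)^-1 *: pt j)).
  by congr (Psi (_, torus_pi _)); apply/rowP => k; rewrite mxE.
apply: (@le_trans _ _ (r' * (ci * C))); last first.
  rewrite /r' mulrAC ler_pdivrMr// ler_wpM2l ?(ltW r0)//; lra.
apply: charge_integral_step => //.
- by move=> j; rewrite A_preimage.
- by apply: (measurable_two_scale cPsi); exact: subset_closure.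
- exact: ltW.
- move=> y Oy; set j := word_tuple _ _.
  have Ay : A j y by split => //=; rewrite val_word_tuple// size_fword.
  have [Opt wpt] := ptP Ay.
  rewrite -(torus_pi_frac ((eps n)^-1 *: y)) /f -(torus_pi_frac ((eps n)^-1 *:
    pt j)).
  have close : forall k, `|feat n y k - feat n (pt j) k| <= e.
    apply: hN; [exact/featM/subset_closure|exact/featM/subset_closure|].
    rewrite -(take_fword _ Nn) -[RHS](take_fword _ Nn) wpt.
    by rewrite val_word_tuple// size_fword.
  apply: he => //; [exact: subset_closure|exact: subset_closure| | | |].
  + exact: frac_row_itv.
  + exact: frac_row_itv.
  + by move=> k; exact: (close (inl k)).
  + by move=> k; exact: (close (inr k)).
- move=> A' B' mA' mB' A'O B'O AB; rewrite /vcoord/=.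
  apply: (@le_trans _ _ (ci * (enorm dot (mu n A') + enorm dot (mu n B')))).
    by rewrite mulrDr lerD.
  rewrite ler_wpM2l// -lee_fin; apply: le_trans (mu_le n).
  exact: enormD_le_vtotal_variation.
Qed.

Lemma two_scale_compactness :
  exists (phi : nat -> nat)
         (kappa : {finite_measure set X -> \bar R})
         (theta : X -> vmeasure dot (borel (torus R d))),
    [/\ {homo phi : m n / (m < n)%N}, kappa (~` K) = 0%E,
        weakstar_measurable kappa K theta,
        two_scale_cvg Omega (eps \o phi) (mu \o phi) kappa theta &
        (gprod kappa K (fun x => vtotal_variation (theta x))
           (K `*` [set: torus R d])
         <= limn_einf (fun n => vtotal_variation (mu n) Omega))%E].
Proof.
have [|l lE lfreq] := @limn_einf_frequently R
    (fun n => vtotal_variation (mu n) Omega) C.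
  by move=> n; rewrite tv_ge0 mu_le.
have [M1 M11 KM1] := K_bounded; have [M2 M20 QM2] := unit_features_bounded dot
  'I_d.
have [||||||||phi [kappa [G [s [hphi kK kT [mG GP ms sQ] GH]]]]] :=
    @compactness_disintegration R d Iq K (@unit_features R E dot 'I_d) (M1 +
      M2) C l
      (fun n => n.-tuple bool) wt pt feature tv closedK.
- by move=> y Ky i; rewrite (le_trans (KM1 y Ky i))// lerDl.
- exact: unit_features_closed.
- by move=> t Qt i; rewrite (le_trans (QM2 t Qt i))// lerDr (le_trans ler01).
- by move=> n j; exact: enorm_ge0.
- by move=> n j /wt_gt0[h1 h2]; split => //; exact: subset_closure.
- exact: wt_le.
- exact: tv_le.
- exact: lfreq.
have G01 p : G p -> 0 <= p.2 < 1 by move=> /GP[].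
have [theta [thetaE theta1]] := kernel_measure_exists mG G01 ms sQ.
have mK : measurable (K : set X).
  rewrite -(setCK K); apply: measurableC; apply: sub_sigma_algebra.
  exact: closed_openC.
exists phi, kappa, theta; split => //.
- move=> B mB V oV.
  (* The preimage is already a Borel set, so the negligible part is empty. *)
  exists (K `&` (fun y => theta y B) @^-1` V); last first.
    by exists set0; [exact: negligible_set0|rewrite setU0].
  apply: (@coord_open_measurable _ X R 'I_dE K _
    (fun i y => kernel_coord G s y i B)) => //.
    move=> i; apply: measurable_funTS.
    exact: (measurable_kernel_coord mG G01 ms sQ kappa).
  move=> y Ky /= Vy; have [r r0 rV] := oV _ Vy.
  pose D := 1 + \sum_(i < dE) enorm dot b`_i.
  have D0 : 0 < D by rewrite ltr_wpDr// sumr_ge0// => i _; exact: enorm_ge0.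
  exists (r / D); first exact: divr_gt0.
  move=> y' Ky' yy'; apply: rV; rewrite !thetaE -sumrB.
  apply: (@le_lt_trans _ _ (r / D * \sum_(i < dE) enorm dot b`_i)).
    apply: le_trans (enorm_sum _ _) _; rewrite mulr_sumr; apply: ler_sum => i _.
    by rewrite -scalerBl enormZ ler_wpM2r ?enorm_ge0// ltW.
  rewrite mulrAC ltr_pdivrMr// ltr_pM2l// /D; lra.
- move=> Psi cPsi.
  have [B B0 PsiB] := two_scale_bounded cPsi compactK.
  pose al n i := charge_integral (vcoord (mu (phi n)) i) Omega
    (fun y => Psi (y, torus_pi ((eps (phi n))^-1 *: y))).
  pose be i := Rintegral (kappa \x @lebesgue_measure R)%E G
    (fun p => integrand Psi i p.1 (s p)).
  have phi_ge n : (n <= phi n)%N.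
    by elim: n => // n IH; apply: leq_ltn_trans IH _; exact: hphi.
  have phiy : phi n @[n --> \oo] --> \oo.
    apply/cvgnyPge => N; near=> n; apply: leq_trans (phi_ge n).
    by near: n; exact: nbhs_infty_ge.
  have albe i : al n i @[n --> \oo] --> be i.
    pose S n := \sum_(j : (phi n).-tuple bool) wt j *
      integrand Psi i (pt j) (feature j).
    have h1 : al n i - S n @[n --> \oo] --> (0 : R).
      exact: (cvg_comp _ _ phiy (discretization i cPsi)).
    have [mH h2] := GH (integrand Psi i) (integrand_unif i cPsi).
    rewrite (_ : al ^~ i = (fun n => al n i - S n + S n)).
      by rewrite -[be i]add0r; exact: cvgD h1 h2.
    by apply/funext => n; rewrite subrK.
  have beE i : Rintegral kappa K (fun y => coord b i (vintegral (theta y)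
      [set: borel (torus R d)] (fun xi => Psi (y, xi)))) = be i.
    have [mH _] := GH (integrand Psi i) (integrand_unif i cPsi).
    have <- : Rintegral kappa setT (fun y => Rintegral (@lebesgue_measure R)
        (xsection G y) (fun u => integrand Psi i (y, u).1 (s (y, u)))) = be i.
      apply: (@Rintegral_section_integral _ _ _ _ _ _ _ _ _ (B * M2)) => //.
        exact: product_unit_finite.
      move=> p Gp; rewrite normrM ler_pM//; first by apply: PsiB;
        have [] := GP p Gp.
      exact/QM2/sQ.
    (* For [y] outside [K] the section of [G] is empty, so restricting to [K] does not change the
       integral given by Fubini. *)
    rewrite Rintegral_mkcond; apply: eq_Rintegral => y _; rewrite patchE.
    case: ifPn => [/set_mem Ky|/negP Ky].
      rewrite coord_sum_free; last exact: basis_free (vbasisP _).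
      apply: (charge_integral_kernel mG G01 ms sQ) => //.
      - exact: (measurable_two_scale_torus cPsi).
      - by move=> xi; exact: PsiB.
    rewrite (_ : xsection G y = set0) ?Rintegral_set0//.
    apply/seteqP; split => // u; rewrite /xsection/= inE => /GP[Ky' _].
    by apply: Ky; rewrite inE.
  rewrite /ecvg /eintegral; under eq_bigr do rewrite beE.
  apply: (@squeeze_cvgr _ _ _ _ (cst 0)
    (fun n => \sum_(i < dE) `|al n i - be i| * enorm dot b`_i)).
  + apply: nearW => n; rewrite enorm_ge0/= /vintegral -sumrB.
    apply: le_trans (enorm_sum _ _) _; apply: ler_sum => i _.
    by rewrite -scalerBl enormZ.
  + exact: cvg_cst.
  + have : \sum_(i < dE) `|al n i - be i| * enorm dot b`_i @[n --> \oo] -->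
        \sum_(i < dE) (0 * enorm dot b`_i).
      apply: cvg_big => [|i _]; first exact: add_continuous.
      apply: cvgM; last exact: cvg_cst.
      by apply/norm_cvg0P/subr_cvg0; exact: albe.
    by rewrite big1// => i _; rewrite mul0r.
- rewrite lE; apply: le_trans kT; rewrite /gprod.
  apply: (@le_trans _ _ (\int[kappa]_(y in K) 1)%E).
    (* Comparison with the constant one is pointwise on [K], without measurability of the inner
       integral in [y]. *)
    apply: le_ge0_integral_raw => // y Ky.
    rewrite (_ : (fun xi => _) = (fun=> 1%E)); first exact: theta1.
    by apply/funext => xi; rewrite indicE mem_set.
  rewrite integral_cst// mul1e; apply: le_measure; rewrite ?inE//.
Unshelve. all: by end_near. Qed.

End two_scale_compactness.

Theorem corollary3p12 (R : realType) (d : nat) (Omega : set 'rV[R]_d)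
    (E : vectType R) (dot : {dot E for @idfun R})
    (eps : nat -> R) (mu : nat -> vmeasure dot (borel 'rV[R]_d)) :
  open Omega -> bounded_set Omega ->
  lebesgue_Rd (closure Omega `\` interior Omega) = 0%E ->
  (forall n, 0 < eps n) -> eps n @[n --> \oo] --> (0 : R) ->
  (forall n, concentrated_on (mu n) Omega) ->
  (exists C : R, forall n, (vtotal_variation (mu n) Omega <= C%:E)%E) ->
  exists (phi : nat -> nat)
         (kappa : {finite_measure set (borel 'rV[R]_d) -> \bar R})
         (theta : borel 'rV[R]_d -> vmeasure dot (borel (torus R d))),
    [/\ {homo phi : m n / (m < n)%N},
        kappa (~` closure Omega) = 0%E,
        weakstar_measurable kappa (closure Omega) theta,
        two_scale_cvg Omega (eps \o phi) (mu \o phi) kappa theta &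
        (gprod kappa (closure Omega) (fun x => vtotal_variation (theta x))
           (closure Omega `*` [set: torus R d])
         <= limn_einf (fun n => vtotal_variation (mu n) Omega))%E].
Proof.
move=> openO boundedO _ _ _ _ [C mu_le].
exact: two_scale_compactness mu_le.
Qed.
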